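(* Let $T$ be a compact connected oriented smooth $5$-manifold and let $\mathscr{S}\to T$ be a Hermitian complex vector bundle of rank $4$ (a rank-$4$ Bloch bundle) equipped with a quaternionic structure $\Theta$. Let $\mathcal{H}_0$ be the real vector bundle of traceless Hermitian endomorphisms of $\mathscr{S}$, with fibrewise inner product $\langle H_1,H_2\rangle=\tfrac14\mathrm{tr}(H_1H_2)$, and let $\mathcal{H}_{0,l}\subset\mathcal{H}_0$ consist of those elements that commute with $\Theta$. Then $\mathcal{H}_{0,l}$ is a real orientable rank-$5$ subbundle of $\mathcal{H}_0$ consisting of Dirac-type Hamiltonians, i.e. locally it has an orthonormal frame $\{\gamma_1,\dots,\gamma_5\}$ satisfying $\gamma_i\gamma_j+\gamma_j\gamma_i=2\delta_{ij}$, so that its elements are exactly those of the form $\boldsymbol{h}\cdot\boldsymbol{\gamma}=\sum_{i=1}^5 h^i\gamma_i$ with $h^i$ real. Moreover, the chirality condition $\gamma_5=\gamma_1\gamma_2\gamma_3\gamma_4$ for an orthonormal frame $\{\gamma_1,\dots,\gamma_5\}$ of $\mathcal{H}_{0,l}$ defines an orientation of $\mathcal{H}_{0,l}$ (the positive orientation): there is an orientation of $\mathcal{H}_{0,l}$ for which the positively oriented orthonormal frames are precisely those satisfying this condition.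
   Context: A quaternionic structure $\Theta$ on a Hermitian vector bundle $\mathscr{S}\to T$ is a smooth bundle map $\Theta:\mathscr{S}\to\mathscr{S}$ covering the identity of $T$, antiunitary on each fibre, with $\Theta^2=-1$. A (Bloch) Hamiltonian at $k\in T$ is a Hermitian endomorphism of the fibre $\mathscr{S}_k\cong\mathbb{C}^4$. *)

(* Defs.v *)
From HB Require Import structures.
From mathcomp Require Import all_boot all_order all_algebra.
From mathcomp Require Import all_classical all_reals all_analysis.
From mathcomp Require Import complex.
Import Order.TTheory GRing.Theory Num.Theory.
Import numFieldNormedType.Exports.

Set Implicit Arguments.
Unset Strict Implicit.
Unset Printing Implicit Defensive.

Local Open Scope classical_set_scope.
Local Open Scope ring_scope.

Section SmoothEuclidean.
Variables (R : realType) (n : nat).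

(* [f] is C^k on the open set [U]; its values outside [U] play no role. *)
Fixpoint Ck_on (k : nat) (U : set 'rV[R]_n) (f : 'rV[R]_n -> R) : Prop :=
  match k with
  | 0 => {in U, continuous f}
  | k'.+1 => {in U, continuous f} /\
      forall i : 'I_n,
        {in U, forall x, derivable f x (delta_mx 0 i)} /\
        Ck_on k' U (fun x => 'D_(delta_mx 0 i) f x)
  end.

Definition smooth_on (U : set 'rV[R]_n) (f : 'rV[R]_n -> R) : Prop :=
  forall k, Ck_on k U f.

Definition smooth_map_on m (U : set 'rV[R]_n) (f : 'rV[R]_n -> 'rV[R]_m) : Prop :=
  forall i : 'I_m, smooth_on U (fun x => f x 0 i).

End SmoothEuclidean.

(* A homeomorphism from an open subset of [T] onto an open subset of R^n; the
   values of [cmap] and [cinv] outside these two open sets are irrelevant. *)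
Record chart (R : realType) (T : topologicalType) (n : nat) := Chart {
  cdom : set T;
  cmap : T -> 'rV[R]_n;
  cinv : 'rV[R]_n -> T;
  cdom_open : open cdom;
  cimg_open : open (cmap @` cdom);
  cmapK : {in cdom, cancel cmap cinv};
  cmap_continuous : {in cdom, continuous cmap};
  cinv_continuous : {in cmap @` cdom, continuous cinv}
}.

Section Manifolds.
Variables (R : realType) (T : topologicalType) (n : nat).
Implicit Types (c d : chart R T n) (A : set (chart R T n)).

Definition transition c d : 'rV[R]_n -> 'rV[R]_n := cmap d \o cinv c.

Definition overlap c d : set 'rV[R]_n := cmap c @` (cdom c `&` cdom d).

Definition compatible c d : Prop :=
  smooth_map_on (overlap c d) (transition c d) /\
  smooth_map_on (overlap d c) (transition d c).

Definition smooth_structure A : Prop :=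
  [/\ forall x, exists2 c, A c & cdom c x,
      forall c d, A c -> A d -> compatible c d &
      forall c, (forall d, A d -> compatible c d) -> A c].

(* An orientation of the manifold, given by an oriented atlas [O] contained in
   the smooth structure [A]. *)
Definition manifold_orientation A (O : set (chart R T n)) : Prop :=
  [/\ O `<=` A,
      forall x, exists2 c, O c & cdom c x &
      forall c d, O c -> O d ->
        {in overlap c d, forall p, 0 < \det ('J (transition c d) p)}].

Definition smooth_manifold A : Prop :=
  [/\ hausdorff_space T, @second_countable T & smooth_structure A].

Definition smooth_real A (W : set T) (f : T -> R) : Prop :=
  forall c, A c -> smooth_on (cmap c @` (cdom c `&` W)) (f \o cinv c).

Definition smooth_complex A (W : set T) (f : T -> R[i]) : Prop :=
  smooth_real A W (fun x => complex.Re (f x)) /\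
  smooth_real A W (fun x => complex.Im (f x)).

End Manifolds.

Record trivialization (R : realType) (T : topologicalType)
    (S : T -> vectType R[i]) (r : nat) := Trivialization {
  tdom : set T;
  tmap : forall x, 'Hom(S x, 'cV[R[i]]_r);
  tdom_open : open tdom;
  tmap_bij : forall x, tdom x -> bijective (tmap x)
}.

Section Bundles.
Variables (R : realType) (T : topologicalType) (n r : nat).
Variable A : set (chart R T n).
Variable S : T -> vectType R[i].
Implicit Types (V : set (trivialization S r)) (W : set T).

(* The smooth structure on the total space of [S] is encoded by a bundle atlas
   whose transition functions x |-> t' x \o (t x)^-1 are smooth maps into GL_r;
   smoothness of a matrix-valued map is tested on the vectors of C^r. *)
Definition vector_bundle V : Prop :=
  (forall x, exists2 t, V t & tdom t x) /\
  (forall t t', V t -> V t' -> forall (v : 'cV[R[i]]_r) (i : 'I_r),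
     smooth_complex A (tdom t `&` tdom t')
       (fun x => tmap t' x ((tmap t x)^-1%VF v) i 0)).

(* The metric is conjugate-linear in its first argument. *)
Definition hermitian_metric V (h : forall x, S x -> S x -> R[i]) : Prop :=
  [/\ forall x (u v w : S x) (a : R[i]), h x u (a *: v + w) = a * h x u v + h x u w,
      forall x (u v : S x), h x v u = (h x u v)^*,
      forall x (u : S x), u != 0 -> 0 < h x u u &
      forall t, V t -> forall u v : 'cV[R[i]]_r,
        smooth_complex A (tdom t)
          (fun x => h x ((tmap t x)^-1%VF u) ((tmap t x)^-1%VF v))].

(* Smoothness over [W] of a fibrewise real-linear bundle map [B], that is, of
   its matrix coefficients in the trivializations. Applied to complex-linear
   [B] this is smoothness of a section of the endomorphism bundle. *)
Definition smooth_bundle_map V W (B : forall x, S x -> S x) : Prop :=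
  forall t, V t -> forall (v : 'cV[R[i]]_r) (i : 'I_r),
    smooth_complex A (W `&` tdom t)
      (fun x => tmap t x (B x ((tmap t x)^-1%VF v)) i 0).

Definition quaternionic_structure V (h : forall x, S x -> S x -> R[i])
    (Theta : forall x, S x -> S x) : Prop :=
  [/\ smooth_bundle_map V setT Theta,
      forall x (u v : S x) (a : R[i]),
        Theta x (a *: u + v) = a^* *: Theta x u + Theta x v,
      forall x (u v : S x), h x (Theta x u) (Theta x v) = (h x u v)^* &
      forall x (u : S x), Theta x (Theta x u) = - u].

End Bundles.

Section RealSubspaces.
Variables (R : realType) (E : lmodType R[i]) (k : nat).
Implicit Types (F : set E) (b : 'I_k -> E).

Definition real_comb (c : 'I_k -> R) b : E := \sum_i (c i)%:C%C *: b i.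

(* [F] is a real linear subspace of [E] with basis [b]. *)
Definition real_basis F b : Prop :=
  (forall H, F H <-> exists c, H = real_comb c b) /\
  (forall c, real_comb c b = 0 -> forall i, c i = 0).

(* An orientation of the real vector space [F] is the set [O] of its positively
   oriented bases: one class of bases modulo matrices of positive determinant. *)
Definition space_orientation F (O : set ('I_k -> E)) : Prop :=
  O !=set0 /\
  forall b, O b -> real_basis F b /\
    forall (P : 'M[R]_k) b', real_basis F b' ->
      (forall j, b' j = real_comb (P^~ j) b) -> (O b' <-> 0 < \det P).

End RealSubspaces.

Section RealSubbundles.
Variables (R : realType) (T : topologicalType) (n r : nat).
Variable A : set (chart R T n).
Variable S : T -> vectType R[i].
Variable V : set (trivialization S r).
Implicit Types (F G : forall x, set 'End(S x)).

(* Families [F] of real subspaces of the fibres of End(S). *)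
Definition smooth_frame k F (W : set T) (s : 'I_k -> forall x, 'End(S x)) : Prop :=
  (forall i, smooth_bundle_map A V W (fun x => s i x)) /\
  (forall x, W x -> real_basis (F x) (fun i => s i x)).

Definition real_vector_bundle k F : Prop :=
  forall x, exists W s, [/\ open W, W x & @smooth_frame k F W s].

(* [F] is a rank [k] subbundle of the real vector bundle [G]: around every point
   there is a local trivialization of [G], given by a frame, which maps [F] onto
   the subspace R^k of R^(k + q). *)
Definition real_subbundle k F G : Prop :=
  exists q, forall x, exists W (s : 'I_(k + q) -> forall x, 'End(S x)),
    [/\ open W, W x, smooth_frame G W s &
        smooth_frame F W (fun i : 'I_k => s (lshift q i))].

Definition bundle_orientation k F (O : forall x, set ('I_k -> 'End(S x))) : Prop :=
  (forall x, space_orientation (F x) (O x)) /\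
  (forall x, exists W s, [/\ open W, W x, smooth_frame F W s &
     forall y, W y -> O y (fun i => s i y)]).

Definition bundle_orientable k F : Prop := exists O, @bundle_orientation k F O.

End RealSubbundles.

Section Hamiltonians.
Variables (R : realType) (E : vectType R[i]).
Implicit Types H : 'End(E).

Definition endo_trace H : R[i] := \tr (passmx.mxof (vbasis {:E}) (vbasis {:E}) H).

Definition endo_inner H1 H2 : R[i] := 4^-1 * endo_trace (H1 \o H2)%VF.

Definition traceless_hermitian (h : E -> E -> R[i]) : set 'End(E) :=
  [set H : 'End(E) | (forall u v, h (H u) v = h u (H v)) /\ endo_trace H = 0].

Definition theta_invariant (h : E -> E -> R[i]) (Theta : E -> E) : set 'End(E) :=
  [set H : 'End(E) | traceless_hermitian h H /\ forall u, H (Theta u) = Theta (H u)].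

Definition orthonormal_basis k (F : set 'End(E)) (g : 'I_k -> 'End(E)) : Prop :=
  real_basis F g /\ forall i j, endo_inner (g i) (g j) = (i == j)%:R.

Definition clifford k (g : 'I_k -> 'End(E)) : Prop :=
  forall i j, ((g i \o g j) + (g j \o g i))%VF = (2 * (i == j)%:R) *: \1%VF.

(* gamma_5 = gamma_1 gamma_2 gamma_3 gamma_4, with indices starting at 0. *)
Definition chiral (g : 'I_5 -> 'End(E)) : Prop :=
  g (inord 4) = (g (inord 0) \o g (inord 1) \o g (inord 2) \o g (inord 3))%VF.

End Hamiltonians.

(* Main.v *)
(* Around each point, quaternionic Gram-Schmidt gives a smooth orthonormal frame
   (u, Theta u, w, Theta w) of S: u is orthogonal to Theta u because Theta is
   antiunitary of square -1. In such a frame traceless Hermitian endomorphisms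
   become a 15-parameter family of matrices, and those commuting with Theta the
   5-parameter family obtained by setting the last 10 parameters to 0; products
   of the latter satisfy AB + BA = 2<A,B>, so every orthonormal frame satisfies
   the Clifford relations. For five elements with coordinate matrix P in the
   model frame, tr (g_1 ... g_5) = 4 det P. If the g_j are orthonormal, the
   product g_1 ... g_5 is unitary, hence it equals 1 exactly when det P = 1; so
   chirality selects one of the two classes of orthonormal frames. *)
Require Import Defs.
From HB Require Import structures.
From mathcomp Require Import all_boot all_order all_algebra.
From mathcomp Require Import all_classical all_reals all_analysis.
From mathcomp Require Import complex.
From mathcomp Require Import ring lra.
Import Order.TTheory GRing.Theory Num.Theory.
Import numFieldNormedType.Exports.

Set Implicit Arguments.
Unset Strict Implicit.
Unset Printing Implicit Defensive.

Local Open Scope classical_set_scope.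
Local Open Scope ring_scope.

(** * Four-by-four Clifford matrices *)

(** Five is the real dimension of the traceless Hermitian 2 by 2 matrices over the quaternions. Once
    the frame is grouped into the pairs [(u, Theta u)] and [(w, Theta w)], an operator commuting
    with [Theta] has diagonal blocks [a] and [-a] with [a] real, and off-diagonal blocks a
    quaternion [q] and its adjoint. Its square is the scalar [a^2 + |q|^2], and polarizing this
    gives the Clifford relations. That a unitary [W] of trace 4 equals 1 is the equality case of
    [|tr W| <= 4]: the adjoint of [W - 1] times [W - 1] has trace 0. Adapted frames of the bundle
    exist only locally, and no compatible choice of them is made. The orientation is global all the
    same, because it is defined through chirality, which mentions no frame of the bundle. An adapted
    frame at a point serves only to compute determinants there. *)

Section LaplaceExpansion.
Variable K : comRingType.

(** Unlike [\det], this reduces by computation, so a determinant of explicit size becomes a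
    polynomial that [ring] can compare. With entries indexed by [nat], a minor is a mere reindexing
    through [bump]. *)
Fixpoint laplace n (m : nat -> nat -> K) : K :=
  if n is n'.+1 then
    foldr +%R 0 [seq (-1) ^+ j * (m 0%N j * laplace n' (fun i k => m i.+1 (bump j k)))
                | j <- iota 0 n]
  else 1.

Lemma det_laplace n (m : nat -> nat -> K) :
  \det (\matrix_(i < n, j < n) m i j) = laplace n m.
Proof.
elim: n m => [|n IHn] m; first by rewrite det_mx00.
transitivity (\sum_(0 <= j < n.+1)
    (-1) ^+ j * (m 0%N j * laplace n (fun i k => m i.+1 (bump j k)))); last first.
  by rewrite unlock /= foldr_map.
rewrite big_mkord (expand_det_row _ 0); apply: eq_bigr => j _.
rewrite /cofactor !mxE add0n mulrCA -IHn.
congr (_ * (_ * \det _)).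
by apply/matrixP => i k; rewrite !mxE.
Qed.

End LaplaceExpansion.

Section FourByFour.
Variable K : comRingType.

Definition mx4 (s : seq (seq K)) : 'M[K]_4 := \matrix_(i, j) nth 0 (nth [::] s i) j.

Lemma mx4P (M N : 'M[K]_4) :
  (forall i j : nat, (i < 4)%N -> (j < 4)%N -> M (inord i) (inord j) = N (inord i) (inord j)) ->
  M = N.
Proof.
by move=> MN; apply/matrixP => i j; rewrite -(inord_val i) -(inord_val j) MN.
Qed.

Lemma mx4_eta (M : 'M[K]_4) (m := fun i j => M (inord i) (inord j)) :
  M = mx4 [:: [:: m 0 0; m 0 1; m 0 2; m 0 3]; [:: m 1 0; m 1 1; m 1 2; m 1 3];
              [:: m 2 0; m 2 1; m 2 2; m 2 3]; [:: m 3 0; m 3 1; m 3 2; m 3 3]]%N.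
Proof.
apply: mx4P => i j; rewrite !mxE => i4 j4; rewrite !inordK//.
by case: i i4 => [|[|[|[|i]]]] //= _; case: j j4 => [|[|[|[|j]]]].
Qed.

Section Entries.
Variables (a0 a1 a2 a3 a4 a5 a6 a7 a8 a9 a10 a11 a12 a13 a14 a15 : K).
Variables (b0 b1 b2 b3 b4 b5 b6 b7 b8 b9 b10 b11 b12 b13 b14 b15 : K).
Let A := mx4 [:: [:: a0; a1; a2; a3]; [:: a4; a5; a6; a7];
                 [:: a8; a9; a10; a11]; [:: a12; a13; a14; a15]].
Let B := mx4 [:: [:: b0; b1; b2; b3]; [:: b4; b5; b6; b7];
                 [:: b8; b9; b10; b11]; [:: b12; b13; b14; b15]].

Lemma mx4M : A *m B =
  mx4 [:: [:: a0*b0+a1*b4+a2*b8+a3*b12; a0*b1+a1*b5+a2*b9+a3*b13;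
              a0*b2+a1*b6+a2*b10+a3*b14; a0*b3+a1*b7+a2*b11+a3*b15];
          [:: a4*b0+a5*b4+a6*b8+a7*b12; a4*b1+a5*b5+a6*b9+a7*b13;
              a4*b2+a5*b6+a6*b10+a7*b14; a4*b3+a5*b7+a6*b11+a7*b15];
          [:: a8*b0+a9*b4+a10*b8+a11*b12; a8*b1+a9*b5+a10*b9+a11*b13;
              a8*b2+a9*b6+a10*b10+a11*b14; a8*b3+a9*b7+a10*b11+a11*b15];
          [:: a12*b0+a13*b4+a14*b8+a15*b12; a12*b1+a13*b5+a14*b9+a15*b13;
              a12*b2+a13*b6+a14*b10+a15*b14; a12*b3+a13*b7+a14*b11+a15*b15]].
Proof.
apply/matrixP => i j; rewrite !mxE !big_ord_recl big_ord0 /= !mxE.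
by case: i => [[|[|[|[|i]]]] hi] //=; case: j => [[|[|[|[|j]]]] hj] //=; ring.
Qed.

Lemma mx4D : A + B =
  mx4 [:: [:: a0+b0; a1+b1; a2+b2; a3+b3]; [:: a4+b4; a5+b5; a6+b6; a7+b7];
          [:: a8+b8; a9+b9; a10+b10; a11+b11]; [:: a12+b12; a13+b13; a14+b14; a15+b15]].
Proof.
apply/matrixP => i j; rewrite !mxE.
by case: i => [[|[|[|[|i]]]] hi] //=; case: j => [[|[|[|[|j]]]] hj].
Qed.

Lemma mx4_map (f : K -> K) : map_mx f A =
  mx4 [:: [:: f a0; f a1; f a2; f a3]; [:: f a4; f a5; f a6; f a7];
          [:: f a8; f a9; f a10; f a11]; [:: f a12; f a13; f a14; f a15]].
Proof.
apply/matrixP => i j; rewrite !mxE.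
by case: i => [[|[|[|[|i]]]] hi] //=; case: j => [[|[|[|[|j]]]] hj].
Qed.

Lemma mx4_tr : \tr A = a0 + a5 + a10 + a15.
Proof. by rewrite /mxtrace !big_ord_recl big_ord0 !mxE /=; ring. Qed.

End Entries.

(** The Clifford space in isotropic coordinates: the square of this matrix is the scalar
    [a^2 + z z' + u u']. The five parameters are independent, so the identities below are polynomial
    and involve no conjugation. *)
Definition clifford_mx (a z z' u u' : K) : 'M[K]_4 :=
  mx4 [:: [:: a; 0; z; u]; [:: 0; a; - u'; z']; [:: z'; - u; - a; 0]; [:: u'; z; 0; - a]].

Lemma clifford_mx_anticomm a z z' u u' b w w' v v' :
  clifford_mx a z z' u u' *m clifford_mx b w w' v v' +
  clifford_mx b w w' v v' *m clifford_mx a z z' u u' =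
  (2 * a * b + z * w' + z' * w + u * v' + u' * v)%:M.
Proof.
rewrite /clifford_mx !mx4M mx4D; apply/matrixP => i j; rewrite !mxE.
by case: i => [[|[|[|[|i]]]] hi] //=; case: j => [[|[|[|[|j]]]] hj] //=;
  rewrite ?mulr1n ?mulr0n; ring.
Qed.

(* Both sides are alternating in the five vectors of parameters, since a
   product of three or fewer distinct generators has trace 0. *)
Lemma tr_clifford_mx5 (m : nat -> nat -> K)
    (M := fun j => clifford_mx (m 0%N j) (m 1%N j) (m 2%N j) (m 3%N j) (m 4%N j)) :
  \tr (M 0%N *m M 1%N *m M 2%N *m M 3%N *m M 4%N) = \det (\matrix_(i < 5, j < 5) m i j).
Proof.
rewrite det_laplace /M /clifford_mx !mx4M mx4_tr /= /bump /=.
by ring.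
Qed.

End FourByFour.

(** * Real bases and their transition matrices *)

Section RealCombinations.
Variables (R : realType) (E : lmodType R[i]).
Implicit Types F : set E.

Local Open Scope complex_scope.

Lemma real_comb_delta k (b : 'I_k -> E) j : real_comb (fun i => (i == j)%:R) b = b j.
Proof.
rewrite /real_comb (bigD1 j)//= eqxx scale1r big1 ?addr0// => i /negPf ->.
by rewrite scale0r.
Qed.

Lemma real_comb_mul k l (b : 'I_k -> E) (b' : 'I_l -> E) (P : 'I_k -> 'I_l -> R) c :
  (forall j, b' j = real_comb (P^~ j) b) ->
  real_comb c b' = real_comb (fun i => \sum_j P i j * c j) b.
Proof.
move=> bP; rewrite /real_comb; under eq_bigr do rewrite bP scaler_sumr.
rewrite exchange_big; apply: eq_bigr => i _ /=.
rewrite rmorph_sum scaler_suml; apply: eq_bigr => j _ /=.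
by rewrite scalerA -rmorphM mulrC.
Qed.

Lemma real_basis_mem k F (b : 'I_k -> E) j : real_basis F b -> F (b j).
Proof. by move=> [bF _]; apply/bF; exists (fun i => (i == j)%:R); rewrite real_comb_delta. Qed.

Lemma real_basis_inj k F (b : 'I_k -> E) c d :
  real_basis F b -> real_comb c b = real_comb d b -> c =1 d.
Proof.
move=> [_ bfree] cd i; apply/eqP; rewrite -subr_eq0; apply/eqP.
apply: (bfree (fun i => c i - d i)).
transitivity (real_comb c b - real_comb d b); last by rewrite cd subrr.
by rewrite /real_comb -sumrB; apply: eq_bigr => j _; rewrite rmorphB scalerBl.
Qed.

Lemma real_basis_coord k F (b b' : 'I_k -> E) : real_basis F b ->
  (forall j, F (b' j)) -> exists P : 'M[R]_k, forall j, b' j = real_comb (P^~ j) b.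
Proof.
move=> [bF _] b'F.
have /choice[f fE] j : exists c, b' j = real_comb c b by apply/bF.
exists (\matrix_(i, j) f j i) => j; rewrite fE; apply: eq_bigr => i _.
by rewrite mxE.
Qed.

(** Coordinates in [b] are unique, so transition matrices compose; signs of determinants can then be
    compared along chains of bases. *)
Lemma real_basis_mulmx k F (b b' b'' : 'I_k -> E) (P Q T : 'M[R]_k) : real_basis F b ->
  (forall j, b' j = real_comb (P^~ j) b) -> (forall j, b'' j = real_comb (Q^~ j) b') ->
  (forall j, b'' j = real_comb (T^~ j) b) -> T = P *m Q.
Proof.
move=> bF b'P b''Q b''T; apply/matrixP => i j; rewrite mxE.
have := b''Q j; rewrite b''T (real_comb_mul _ b'P) => /(real_basis_inj bF) ->.
by [].
Qed.

Lemma real_basis_unit k F (b b' : 'I_k -> E) (P : 'M[R]_k) : real_basis F b ->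
  (forall j, b' j = real_comb (P^~ j) b) -> P \in unitmx -> real_basis F b'.
Proof.
move=> bF b'P Pu; have [bFE bfree] := bF.
pose v c := (\col_j c j : 'cV[R]_k).
have sumE (M : 'M[R]_k) c i : \sum_j M i j * c j = (M *m v c) i 0.
  by rewrite mxE; apply: eq_bigr => j _; rewrite mxE.
split=> [H|c].
  rewrite bFE; split=> -[c ->].
    exists (fun j => (invmx P *m v c) j 0); rewrite (real_comb_mul _ b'P).
    congr (real_comb _ b); apply/funext => i; rewrite sumE.
    have -> : v (fun j => (invmx P *m v c) j 0) = invmx P *m v c.
      by apply/colP => j; rewrite mxE.
    by rewrite mulKVmx// mxE.
  by rewrite (real_comb_mul _ b'P); eexists.
rewrite (real_comb_mul _ b'P) => /bfree c0 i.
have : v c = 0.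
  rewrite -(mulKmx Pu (v c)); apply/colP => j.
  have -> : P *m v c = 0 by apply/colP => l; rewrite -sumE c0 mxE.
  by rewrite mulmx0.
by move/colP/(_ i); rewrite !mxE.
Qed.

(** Padding by zeros lets a single parametrization by sequences serve families of length 5 and of
    length 15. *)
Definition extend n (c : 'I_n -> R) : nat -> R := fun m => \sum_k c k * (m == k)%:R.

Lemma extend_ord n (c : 'I_n -> R) (k : 'I_n) : extend c k = c k.
Proof.
rewrite /extend (bigD1 k)//= eqxx mulr1 big1 ?addr0// => i; rewrite -val_eqE /= eq_sym.
by move=> /negPf ->; rewrite mulr0.
Qed.

Lemma extend_ge n (c : 'I_n -> R) m : (n <= m)%N -> extend c m = 0.
Proof.
move=> nm; rewrite /extend big1// => k _.
by rewrite [_ == _]gtn_eqF ?mulr0// (leq_trans (ltn_ord k)).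
Qed.

Lemma real_comb_extend n (L : (nat -> R) -> E) (c : 'I_n -> R) :
  (forall a x y, L (fun m => a * x m + y m) = a%:C *: L x + L y) ->
  real_comb c (fun k : 'I_n => L (fun m => (m == k)%:R)) = L (extend c).
Proof.
move=> Llin; rewrite /real_comb /extend.
(* Linearity is given only in combined form; [a = -1] on zero sequences reads
   [L 0 = - L 0 + L 0]. *)
have L0 : L (fun=> 0) = 0.
  have := Llin (-1) (fun=> 0) (fun=> 0).
  under [fun m : nat => _]eq_fun do rewrite mulr0 addr0.
  by rewrite rmorphN rmorph1 scaleN1r addNr.
suff -> s : L (fun m => \sum_(k <- s) c k * (m == k)%:R) =
    \sum_(k <- s) (c k)%:C *: L (fun m => (m == k)%:R) by [].
elim: s => [|k s IHs].
  by rewrite big_nil -[RHS]L0; congr L; apply/funext => m; rewrite big_nil.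
by rewrite big_cons -IHs -Llin; congr L; apply/funext => m; rewrite big_cons.
Qed.

End RealCombinations.

(** * Hermitian and Dirac matrices in explicit real parameters *)

Section DiracMatrices.
Variable R : realType.
Implicit Types x y : nat -> R.

Local Open Scope complex_scope.

(* Matrix of a traceless Hermitian operator in a basis e, Theta e, f, Theta f;
   the operators commuting with Theta are those with x 5 = ... = x 14 = 0. *)
Definition herm_mx x : 'M[R[i]]_4 :=
  mx4 [:: [:: (x 0%N + x 5%N) +i* 0; x 7%N +i* x 8%N; (x 1%N + x 11%N) +i* (x 2%N + x 12%N);
              (x 3%N + x 13%N) +i* (x 14%N - x 4%N)];
          [:: x 7%N -i* x 8%N; (x 0%N - x 5%N) +i* 0; (x 13%N - x 3%N) -i* (x 4%N + x 14%N);
              (x 1%N - x 11%N) +i* (x 12%N - x 2%N)];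
          [:: (x 1%N + x 11%N) -i* (x 2%N + x 12%N); (x 13%N - x 3%N) +i* (x 4%N + x 14%N);
              (x 6%N - x 0%N) +i* 0; x 9%N +i* x 10%N];
          [:: (x 3%N + x 13%N) -i* (x 14%N - x 4%N); (x 1%N - x 11%N) -i* (x 12%N - x 2%N);
              x 9%N -i* x 10%N; (- x 0%N - x 6%N) +i* 0]].

Definition dirac_mx x := herm_mx (fun n => if (n < 5)%N then x n else 0).

(** Column [j] lists the coordinates of the image under [Theta] of the [j]-th vector of e, Theta e,
    f, Theta f; the signs come from [Theta^2 = -1]. *)
Definition quat_mx : 'M[R[i]]_4 :=
  mx4 [:: [:: 0; -1; 0; 0]; [:: 1; 0; 0; 0]; [:: 0; 0; 0; -1]; [:: 0; 0; 1; 0]].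

Lemma conjE (z : R[i]) : Num.conj z = conjc z.
Proof. by []. Qed.

Lemma complex_eqP (z w : R[i]) :
  complex.Re z = complex.Re w -> complex.Im z = complex.Im w -> z = w.
Proof. by case: z w => [a b] [c d] /= -> ->. Qed.

Lemma herm_mx_linear a x y :
  herm_mx (fun n => a * x n + y n) = a%:C *: herm_mx x + herm_mx y.
Proof.
apply/matrixP => i j; rewrite !mxE.
by case: i => [[|[|[|[|i]]]] hi] //=; case: j => [[|[|[|[|j]]]] hj] //=;
  apply: complex_eqP => /=; ring.
Qed.

Lemma herm_mx_adj x i j : herm_mx x j i = (herm_mx x i j)^*%R.
Proof.
rewrite !mxE.
by case: i => [[|[|[|[|i]]]] hi] //=; case: j => [[|[|[|[|j]]]] hj] //=;
  apply: complex_eqP => /=; ring.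
Qed.

Lemma herm_mx_tr x : \tr (herm_mx x) = 0.
Proof. by rewrite mx4_tr; apply: complex_eqP => /=; ring. Qed.

Lemma herm_mx_inj0 x : herm_mx x = 0 -> forall n, (n < 15)%N -> x n = 0.
Proof.
move=> /matrixP x0.
have z0 i j : herm_mx x (inord i) (inord j) = 0 by rewrite x0 mxE.
(* Three diagonal entries, which are real, and the six entries above the diagonal give the fifteen
   real equations; the last diagonal entry is fixed by the trace. *)
have := (z0 0 0, z0 1 1, z0 2 2, z0 0 1, z0 2 3, z0 0 2, z0 1 3, z0 0 3, z0 1 2)%N.
rewrite !mxE !inordK//= => -[[[[[[[[]]]]]]]] [e1] [e2] [e3] [e4 e5] [e6 e7] [e8 e9] [e10 e11].
move=> [e12 e13] [e14 e15].
move=> n; do 15 (case: n => [_|n]; first by lra).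
by [].
Qed.

Lemma herm_mxP (M : 'M[R[i]]_4) :
  (forall i j, M j i = (M i j)^*%R) -> \tr M = 0 -> exists x, M = herm_mx x.
Proof.
move=> MH; have mH (i j : nat) : M (inord j) (inord i) = (M (inord i) (inord j))^*.
  by rewrite MH conjE.
rewrite (mx4_eta M) /=.
rewrite mx4_tr.
rewrite (mH 0%N 1%N) (mH 0%N 2%N) (mH 0%N 3%N) (mH 1%N 2%N) (mH 1%N 3%N) (mH 2%N 3%N).
move: (mH 0 0)%N (mH 1 1)%N (mH 2 2)%N (mH 3 3)%N.
case: (M (inord 0) (inord 0)) => a0 b0; case: (M (inord 0) (inord 1)) => a1 b1.
case: (M (inord 0) (inord 2)) => a2 b2.
case: (M (inord 0) (inord 3)) => a3 b3; case: (M (inord 1) (inord 1)) => a4 b4.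
case: (M (inord 1) (inord 2)) => a5 b5.
case: (M (inord 1) (inord 3)) => a6 b6; case: (M (inord 2) (inord 2)) => a7 b7.
case: (M (inord 2) (inord 3)) => a8 b8.
case: (M (inord 3) (inord 3)) => a9 b9 /= [e0] [e1] [e2] [e3] [e4 _].
(* Half-sums and half-differences invert the linear system of entries. The last two diagonal entries
   would give [- (a7 + a9) / 2] for the first parameter, which agrees with [(a0 + a4) / 2] since the
   trace vanishes. *)
exists (nth 0 [:: (a0 + a4) / 2; (a2 + a6) / 2; (b2 - b6) / 2; (a3 - a5) / 2;
  (- b3 - b5) / 2; (a0 - a4) / 2; (a7 - a9) / 2; a1; b1; a8; b8;
  (a2 - a6) / 2; (b2 + b6) / 2; (a3 + a5) / 2; (b3 - b5) / 2]) => /=.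
apply/matrixP => i j; rewrite !mxE.
case: i => [[|[|[|[|i]]]] hi] //=; case: j => [[|[|[|[|j]]]] hj] //=;
  apply: complex_eqP => /=; lra.
Qed.

(** In coordinates [Theta] is conjugation followed by [quat_mx], so the matrix equation expresses
    commutation with [Theta]. *)
Lemma herm_mx_quat x :
  herm_mx x *m quat_mx = quat_mx *m map_mx Num.conj (herm_mx x) <->
  forall n, (5 <= n < 15)%N -> x n = 0.
Proof.
split=> [|x0].
  rewrite /herm_mx /quat_mx mx4_map !mx4M => /matrixP e.
  pose o (i : nat) (hi : (i < 4)%N) := Ordinal hi.
  (* The real and imaginary parts of these six entries are enough to force parameters 5 to 14 to
     vanish. *)
  move: (e (o 0%N isT) (o 0%N isT)) (e (o 1%N isT) (o 0%N isT)) (e (o 2%N isT) (o 2%N isT)).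
  move: (e (o 3%N isT) (o 2%N isT)) (e (o 3%N isT) (o 0%N isT)) (e (o 2%N isT) (o 0%N isT)).
  rewrite {e} !mxE /= => -[e0 e1] [e2 e3] [e4 e5] [e6 e7] [e8 e9] [e10 e11].
  move=> n; do 5 (case: n => [//|n]).
  by do 10 (case: n => [_|n]; first by lra).
have {}x0 : herm_mx x = dirac_mx x.
  rewrite /dirac_mx /herm_mx /=.
  by rewrite !(x0 5%N, x0 6%N, x0 7%N, x0 8%N, x0 9%N, x0 10%N, x0 11%N, x0 12%N, x0 13%N, x0 14%N).
rewrite x0 /dirac_mx /herm_mx /quat_mx /= mx4_map !mx4M.
apply/matrixP => i j; rewrite !mxE.
case: i => [[|[|[|[|i]]]] hi] //=; case: j => [[|[|[|[|j]]]] hj] //=;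
  apply: complex_eqP => /=; ring.
Qed.


(** Writing the entries as polynomials in ['i] lets [ring] work modulo ['i * 'i = -1]. The isotropic
    coordinates become two conjugate pairs, with products [x1^2 + x2^2] and [x3^2 + x4^2]. *)
Lemma dirac_mxE x : dirac_mx x =
  clifford_mx (x 0%N)%:C ((x 1%N)%:C + 'i * (x 2%N)%:C) ((x 1%N)%:C - 'i * (x 2%N)%:C)
    ((x 3%N)%:C - 'i * (x 4%N)%:C) ((x 3%N)%:C + 'i * (x 4%N)%:C).
Proof.
apply/matrixP => i j; rewrite !mxE.
by case: i => [[|[|[|[|i]]]] hi] //=; case: j => [[|[|[|[|j]]]] hj] //=;
  apply: complex_eqP => /=; ring.
Qed.

Lemma mulii : 'i * 'i = -1 :> R[i].
Proof. by rewrite -expr2 sqr_i. Qed.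

Lemma dirac_mx_anticomm x y :
  dirac_mx x *m dirac_mx y + dirac_mx y *m dirac_mx x =
  (2 * \sum_(n < 5) x n * y n)%:C%:M.
Proof.
rewrite !dirac_mxE clifford_mx_anticomm; congr _%:M.
rewrite !big_ord_recl big_ord0 /= /bump /= !(rmorphM, rmorphD) /=.
ring: mulii.
Qed.

(** Passing from real to isotropic coordinates multiplies the determinant by [(- 2 i) (2 i) = 4],
    one factor for each conjugate pair. *)
Lemma tr_dirac_mx5 (m : nat -> nat -> R) (M := fun j => dirac_mx (m^~ j)) :
  \tr (M 0%N *m M 1%N *m M 2%N *m M 3%N *m M 4%N) =
  4 * (\det (\matrix_(i < 5, j < 5) m i j))%:C.
Proof.
rewrite /M !dirac_mxE.
pose m' i j := nth 0 [:: (m 0%N j)%:C; (m 1%N j)%:C + 'i * (m 2%N j)%:C;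
    (m 1%N j)%:C - 'i * (m 2%N j)%:C;
    (m 3%N j)%:C - 'i * (m 4%N j)%:C; (m 3%N j)%:C + 'i * (m 4%N j)%:C] i.
rewrite (tr_clifford_mx5 m') -det_map_mx.
have -> : map_mx (real_complex R) (\matrix_(i < 5, j < 5) m i j) =
    \matrix_(i < 5, j < 5) (m i j)%:C.
  by apply/matrixP => i j; rewrite !mxE.
rewrite (det_laplace 5 (fun i j => (m i j)%:C)) det_laplace /m' /= /bump /=.
ring: mulii.
Qed.

Lemma herm_mx_eq x y : (forall n, (n < 15)%N -> x n = y n) -> herm_mx x = herm_mx y.
Proof. by move=> xy; rewrite /herm_mx !xy. Qed.

Lemma dirac_mx_extend (c : 'I_5 -> R) : herm_mx (extend c) = dirac_mx (extend c).
Proof. by apply: herm_mx_eq => n _; case: ltnP => // n5; rewrite extend_ge. Qed.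

End DiracMatrices.

(** * Operators on one quaternionic fibre *)

Section QuaternionicFibre.
Variables (R : realType) (E : vectType R[i]).
Variables (h : E -> E -> R[i]) (Theta : E -> E) (e : 'I_4 -> E).

Definition fibre_metric : Prop :=
  (forall (u v w : E) (a : R[i]), h u (a *: v + w) = a * h u v + h u w) /\
  (forall u v : E, h v u = (h u v)^*).

Definition antilinear : Prop :=
  forall (u v : E) (a : R[i]), Theta (a *: u + v) = a^* *: Theta u + Theta v.

Definition quaternionic_frame : Prop :=
  [/\ forall i j, h (e i) (e j) = (i == j)%:R,
      forall u, u = \sum_i h (e i) u *: e i &
      forall i j, h (e i) (Theta (e j)) = quat_mx R i j].

Hypotheses (hh : fibre_metric) (Th : antilinear) (he : quaternionic_frame).

Lemma metricD u v w : h u (v + w) = h u v + h u w.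
Proof. by have := hh.1 u v w 1; rewrite scale1r mul1r. Qed.

Lemma metric0 u : h u 0 = 0.
Proof. by apply: (addrI (h u 0)); rewrite -metricD !addr0. Qed.

Lemma metricZ u a v : h u (a *: v) = a * h u v.
Proof. by rewrite -[a *: v]addr0 hh.1 metric0 addr0. Qed.

Lemma metric_sum (I : Type) (r : seq I) u (a : I -> R[i]) (v : I -> E) :
  h u (\sum_(k <- r) a k *: v k) = \sum_(k <- r) a k * h u (v k).
Proof.
elim: r => [|k r IHr]; first by rewrite !big_nil metric0.
by rewrite !big_cons metricD metricZ IHr.
Qed.

Lemma antilinear0 : Theta 0 = 0.
Proof.
have := Th 0 0 1; rewrite scaler0 addr0 conjC1 scale1r => /esym/eqP.
by rewrite -subr_eq0 addrK => /eqP.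
Qed.

Lemma antilinear_sum (I : Type) (r : seq I) (a : I -> R[i]) (v : I -> E) :
  Theta (\sum_(k <- r) a k *: v k) = \sum_(k <- r) (a k)^* *: Theta (v k).
Proof.
elim: r => [|k r IHr]; first by rewrite !big_nil antilinear0.
by rewrite !big_cons Th IHr.
Qed.

Lemma frame_expand u : u = \sum_i h (e i) u *: e i.
Proof. by case: he. Qed.

Lemma frame_inj u v : (forall i, h (e i) u = h (e i) v) -> u = v.
Proof.
by move=> uv; rewrite (frame_expand u) (frame_expand v); apply: eq_bigr => i _; rewrite uv.
Qed.

Lemma frame_dot (c : 'I_4 -> R[i]) i : h (e i) (\sum_j c j *: e j) = c i.
Proof.
have [on _ _] := he; rewrite metric_sum (bigD1 i)//= on eqxx mulr1.
by rewrite big1 ?addr0// => j /negPf ji; rewrite on eq_sym ji mulr0.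
Qed.

Lemma lfun_frame (H : 'End(E)) u : H u = \sum_j h (e j) u *: H (e j).
Proof.
rewrite {1}(frame_expand u) linear_sum; apply: eq_bigr => j _; exact: linearZ.
Qed.

Definition frame_mx (H : 'End(E)) : 'M[R[i]]_4 := \matrix_(i, j) h (e i) (H (e j)).

Definition frame_fun (M : 'M[R[i]]_4) (u : E) : E :=
  \sum_i (\sum_j M i j * h (e j) u) *: e i.

Definition frame_lfun (M : 'M[R[i]]_4) : 'End(E) := linfun (frame_fun M).

(** [linfun] accepts any function but agrees only with linear ones. Linearity of [frame_fun] rests
    on the hypothesis on [h], so the linear structure is packed inside the proof. *)
Lemma frame_lfunE M u : frame_lfun M u = frame_fun M u.
Proof.
have lin : linear (frame_fun M).
  move=> a v w; rewrite /frame_fun scaler_sumr -big_split; apply: eq_bigr => i _ /=.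
  rewrite scalerA -scalerDl mulr_sumr -big_split; congr (_ *: _).
  by apply: eq_bigr => j _; rewrite hh.1 mulrDr mulrCA.
pose L : {linear E -> E} :=
  HB.pack (frame_fun M) (GRing.isLinear.Build R[i] E E *:%R (frame_fun M) lin).
exact: (lfunE L).
Qed.

Lemma frame_lfunK : cancel frame_lfun frame_mx.
Proof.
move=> M; apply/matrixP => i j; rewrite mxE frame_lfunE frame_dot.
have [on _ _] := he; rewrite (bigD1 j)//= on eqxx mulr1 big1 ?addr0// => k /negPf kj.
by rewrite on kj mulr0.
Qed.

Lemma frame_mxK : cancel frame_mx frame_lfun.
Proof.
move=> H; apply/lfunP => u; rewrite frame_lfunE; apply: frame_inj => i.
rewrite frame_dot (lfun_frame H u) metric_sum; apply: eq_bigr => j _.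
by rewrite mxE mulrC.
Qed.

Lemma frame_mx_inj : injective frame_mx.
Proof. exact: can_inj frame_mxK. Qed.

Lemma frame_mx_comp H K : frame_mx (H \o K)%VF = frame_mx H *m frame_mx K.
Proof.
apply/matrixP => i j; rewrite !mxE comp_lfunE (lfun_frame H) metric_sum.
by apply: eq_bigr => k _; rewrite !mxE mulrC.
Qed.

Lemma frame_mx1 : frame_mx \1%VF = 1%:M.
Proof. by have [on _ _] := he; apply/matrixP => i j; rewrite !mxE lfunE /= on. Qed.

Lemma frame_mxD H K : frame_mx (H + K) = frame_mx H + frame_mx K.
Proof. by apply/matrixP => i j; rewrite !mxE lfunE metricD. Qed.

Lemma frame_mxZ a H : frame_mx (a *: H) = a *: frame_mx H.
Proof. by apply/matrixP => i j; rewrite !mxE lfunE /= metricZ. Qed.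

Lemma frame_lfunP a M N : frame_lfun (a *: M + N) = a *: frame_lfun M + frame_lfun N.
Proof. by apply: frame_mx_inj; rewrite frame_mxD frame_mxZ !frame_lfunK. Qed.

(** The definition uses an unspecified basis [b]. Expanding [H b_i] in the frame and [e k] in [b]
    gives the same double sum, read in two orders. *)
Lemma endo_trace_frame H : endo_trace H = \tr (frame_mx H).
Proof.
have b_basis := vbasisP {:E}; set b := vbasis {:E} in b_basis *.
have -> : endo_trace H = \sum_i coord b i (H b`_i).
  by apply: eq_bigr => i _; rewrite !mxE /= passmx.vecof_delta.
under eq_bigr do rewrite (frame_expand (H _)) linear_sum.
rewrite exchange_big; apply: eq_bigr => k _; rewrite mxE.
have -> : H (e k) = \sum_i coord b i (e k) *: H b`_i.
  rewrite {1}(coord_basis b_basis (memvf (e k))) linear_sum.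
  by apply: eq_bigr => i _; exact: linearZ.
by rewrite metric_sum; apply: eq_bigr => i _; rewrite linearZ /= mulrC.
Qed.

Lemma metric_frame u v : h u v = \sum_k (h (e k) u)^* * h (e k) v.
Proof.
rewrite {1}(frame_expand v) metric_sum; apply: eq_bigr => k _.
by rewrite -hh.2 mulrC.
Qed.

Lemma frame_mx_hermitian (H : 'End(E)) : (forall u v, h (H u) v = h u (H v)) <->
  (forall i j, frame_mx H j i = (frame_mx H i j)^*).
Proof.
split=> [HH i j|HH u v]; first by rewrite !mxE -hh.2 HH.
have coordE w k : h (e k) (H w) = \sum_j frame_mx H k j * h (e j) w.
  rewrite (lfun_frame H w) metric_sum; apply: eq_bigr => j _.
  by rewrite mxE mulrC.
rewrite (metric_frame (H u)) (metric_frame u).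
under eq_bigr do rewrite coordE rmorph_sum mulr_suml.
rewrite exchange_big; apply: eq_bigr => k _ /=; rewrite coordE mulr_sumr.
by apply: eq_bigr => j _; rewrite rmorphM /= -HH mulrCA mulrA.
Qed.

(** The two composites of [H] and [Theta] are antilinear, so they agree as soon as they agree on the
    frame, and there their coefficients are the two matrix products. *)
Lemma frame_mx_quaternionic (H : 'End(E)) : (forall u, H (Theta u) = Theta (H u)) <->
  frame_mx H *m quat_mx R = quat_mx R *m map_mx Num.conj (frame_mx H).
Proof.
have [_ _ eJ] := he.
have lE i j : (frame_mx H *m quat_mx R) i j = h (e i) (H (Theta (e j))).
  by rewrite (lfun_frame H) metric_sum mxE; apply: eq_bigr => k _; rewrite eJ mxE mulrC.
have rE i j : (quat_mx R *m map_mx Num.conj (frame_mx H)) i j = h (e i) (Theta (H (e j))).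
  rewrite (frame_expand (H (e j))) antilinear_sum metric_sum mxE.
  by apply: eq_bigr => k _; rewrite eJ !mxE mulrC.
split=> [HT|HT u]; first by apply/matrixP => i j; rewrite lE rE HT.
have HTe j : H (Theta (e j)) = Theta (H (e j)).
  by apply: frame_inj => i; rewrite -lE -rE HT.
rewrite (lfun_frame H u) antilinear_sum {1}(frame_expand u) antilinear_sum linear_sum.
by apply: eq_bigr => j _; rewrite -HTe; exact: linearZ.
Qed.

Definition hamiltonian (x : nat -> R) : 'End(E) := frame_lfun (herm_mx x).

(** Only the value of [k] matters, so the five Dirac operators are by conversion the first five of
    the fifteen Hermitian ones. *)
Definition herm_basis n (k : 'I_n) : 'End(E) := hamiltonian (fun m => (m == k)%:R).

Lemma real_comb_herm_basis n (c : 'I_n -> R) :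
  real_comb c (@herm_basis n) = hamiltonian (extend c).
Proof.
apply: real_comb_extend => a x y.
by rewrite /hamiltonian herm_mx_linear frame_lfunP.
Qed.

Lemma traceless_hermitianP H :
  traceless_hermitian h H <-> exists x, H = hamiltonian x.
Proof.
split=> [[/frame_mx_hermitian HH]|[x ->]].
  rewrite endo_trace_frame => /(herm_mxP HH)[x xE]; exists x.
  by rewrite -[LHS]frame_mxK xE.
split; first by apply/frame_mx_hermitian => i j; rewrite frame_lfunK herm_mx_adj.
by rewrite endo_trace_frame frame_lfunK herm_mx_tr.
Qed.

Lemma hamiltonian_inj x y : hamiltonian x = hamiltonian y ->
  forall n, (n < 15)%N -> x n = y n.
Proof.
move=> /(congr1 frame_mx); rewrite !frame_lfunK => xy n n15.
apply/eqP; rewrite -subr_eq0 -[y n]mul1r -mulNr addrC; apply/eqP.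
apply: (@herm_mx_inj0 _ (fun n => -1 * y n + x n)) n15.
by rewrite herm_mx_linear xy rmorphN rmorph1 scaleN1r addNr.
Qed.

Lemma real_basis_hermitian : real_basis (traceless_hermitian h) (@herm_basis 15).
Proof.
split=> [H|c].
  split=> [/traceless_hermitianP[x ->]|[c ->]]; last first.
    by apply/traceless_hermitianP; exists (extend c); rewrite real_comb_herm_basis.
  exists (fun i => x i); rewrite real_comb_herm_basis; congr frame_lfun.
  by apply: herm_mx_eq => n n15; rewrite -[n in RHS]/(val (Ordinal n15)) extend_ord.
rewrite real_comb_herm_basis => c0 i; rewrite -extend_ord.
apply: (@hamiltonian_inj _ (fun=> 0)) (ltn_ord i); rewrite c0; apply: frame_mx_inj.
rewrite frame_lfunK; have := herm_mx_linear (-1) (fun=> 0 : R) (fun=> 0).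
under [fun n : nat => _]eq_fun do rewrite mulr0 addr0.
rewrite rmorphN rmorph1 scaleN1r addNr => ->.
by apply/matrixP => k l; rewrite !mxE lfunE /= metric0.
Qed.

Lemma real_basis_dirac : real_basis (theta_invariant h Theta) (@herm_basis 5).
Proof.
split=> [H|c c0 i].
  split=> [[/traceless_hermitianP[x ->] /frame_mx_quaternionic]|[c ->]].
    rewrite frame_lfunK => /herm_mx_quat x0; exists (fun i => x i).
    rewrite real_comb_herm_basis; congr frame_lfun; apply: herm_mx_eq => n n15.
    have [n5|n5] := ltnP n 5; last by rewrite extend_ge// x0// n5.
    by rewrite -[n in RHS]/(val (Ordinal n5)) extend_ord.
  rewrite real_comb_herm_basis; split; first by apply/traceless_hermitianP; eexists.
  apply/frame_mx_quaternionic; rewrite frame_lfunK; apply/herm_mx_quat => n /andP[n5 _].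
  by rewrite extend_ge.
rewrite real_comb_herm_basis in c0.
(* Independence is inherited from the fifteen operators: five coefficients padded by zeros give the
   same combination. *)
have [_ /(_ (fun i => extend c i))] := real_basis_hermitian.
rewrite real_comb_herm_basis => free.
rewrite -extend_ord -[LHS]/(extend c (widen_ord (isT : (5 <= 15)%N) i)); apply: free.
rewrite -[RHS]c0; congr frame_lfun.
by apply: herm_mx_eq => n n15; rewrite -[n in LHS]/(val (Ordinal n15)) extend_ord.
Qed.

Lemma frame_mx_dirac (c : 'I_5 -> R) :
  frame_mx (real_comb c (@herm_basis 5)) = dirac_mx (extend c).
Proof. by rewrite real_comb_herm_basis frame_lfunK dirac_mx_extend. Qed.

Lemma dirac_anticomm (c d : 'I_5 -> R)
    (A := real_comb c (@herm_basis 5)) (B := real_comb d (@herm_basis 5)) :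
  ((A \o B) + (B \o A))%VF = (2 * \sum_i c i * d i)%:C%C *: \1%VF.
Proof.
apply: frame_mx_inj.
rewrite frame_mxD !frame_mx_comp !frame_mx_dirac dirac_mx_anticomm frame_mxZ frame_mx1 scalemx1.
by do 3 congr (_ _); apply: eq_bigr => i _; rewrite !extend_ord.
Qed.

(** [A B] and [B A] have the same trace, and the anticommutator is a scalar on a space of dimension
    4; hence the factor [8 = 2 * 4]. *)
Lemma dirac_inner (c d : 'I_5 -> R) :
  endo_inner (real_comb c (@herm_basis 5)) (real_comb d (@herm_basis 5)) =
  (\sum_i c i * d i)%:C%C.
Proof.
set A := real_comb c _; set B := real_comb d _.
have : endo_trace (A \o B)%VF + endo_trace (B \o A)%VF = 8 * (\sum_i c i * d i)%:C%C.
  rewrite !endo_trace_frame -mxtraceD -frame_mxD dirac_anticomm frame_mxZ frame_mx1.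
  by rewrite mxtraceZ mxtrace1 rmorphM rmorph_nat /=; ring.
rewrite !endo_trace_frame !frame_mx_comp [\tr (frame_mx B *m _)]mxtrace_mulC.
rewrite /endo_inner endo_trace_frame frame_mx_comp => tr8.
have /mulfI : (8 : R[i]) != 0 by rewrite pnatr_eq0.
by apply; rewrite -tr8; field.
Qed.

Lemma orthonormal_dirac k F (P : 'I_5 -> 'I_k -> R) (g : 'I_k -> 'End(E)) :
  (forall j, g j = real_comb (P^~ j) (@herm_basis 5)) -> orthonormal_basis F g ->
  forall i j, \sum_l P l i * P l j = (i == j)%:R.
Proof.
move=> gP [_ gon] i j; have := gon i j; rewrite !gP dirac_inner => /(congr1 (@complex.Re R)) /= ->.
by case: (i == j).
Qed.

Lemma orthonormal_clifford (g : 'I_5 -> 'End(E)) :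
  orthonormal_basis (theta_invariant h Theta) g -> clifford g.
Proof.
move=> gon; have [P gP] := real_basis_coord real_basis_dirac (fun j => real_basis_mem j gon.1).
move=> i j; rewrite !gP dirac_anticomm (orthonormal_dirac gP gon).
by rewrite rmorphM !rmorph_nat.
Qed.

Lemma orthonormal_herm_basis :
  orthonormal_basis (theta_invariant h Theta) (@herm_basis 5).
Proof.
split=> [|i j]; first exact: real_basis_dirac.
rewrite -(real_comb_delta (@herm_basis 5) i) -(real_comb_delta (@herm_basis 5) j) dirac_inner.
rewrite (bigD1 i)//= eqxx mul1r big1 ?addr0 ?rmorph_nat// => k /negPf ->.
by rewrite mul0r.
Qed.

(** This trace is the sum of the squared moduli of all entries. *)
Lemma trace_adjoint_eq0 n (A : 'M[R[i]]_n) : \tr (map_mx Num.conj A^T *m A) = 0 -> A = 0.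
Proof.
have sqE : \tr (map_mx Num.conj A^T *m A) = \sum_i \sum_j `|A j i| ^+ 2.
  apply: eq_bigr => i _; rewrite mxE; apply: eq_bigr => j _.
  by rewrite !mxE normCKC.
rewrite sqE => A0; apply/matrixP => i j; rewrite mxE; apply/eqP.
have ge0 k l : 0 <= `|A l k| ^+ 2 by rewrite exprn_ge0.
have /(_ j) A0j := psumr_eq0P (fun k _ => sumr_ge0 _ (fun l _ => ge0 k l)) A0.
have /(_ i isT)/eqP := psumr_eq0P (fun l _ => ge0 j l) (A0j isT).
by rewrite expf_eq0 normr_eq0.
Qed.

(* W = g_0 g_1 g_2 g_3 g_4 is unitary with trace 4 det P, so that W = 1 as soon
   as det P = 1. *)
Lemma chiral_det (g : 'I_5 -> 'End(E)) (P : 'M[R]_5) :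
  orthonormal_basis (theta_invariant h Theta) g ->
  (forall j, g j = real_comb (P^~ j) (@herm_basis 5)) -> (chiral g <-> 0 < \det P).
Proof.
move=> gon gP; pose G j := frame_mx (g (inord j)).
have Gj j : G j = dirac_mx (extend (P^~ (inord j))) by rewrite /G gP frame_mx_dirac.
have PP : P^T *m P = 1%:M.
  apply/matrixP => i j; rewrite !mxE -(orthonormal_dirac gP gon).
  by apply: eq_bigr => k _; rewrite mxE.
have detP2 : \det P ^+ 2 = 1 by rewrite expr2 -{1}det_tr -det_mulmx PP det1.
have GG j : G j *m G j = 1%:M.
  rewrite -frame_mx_comp -frame_mx1; congr frame_mx.
  have /scalerI : (2 : R[i]) != 0 by rewrite pnatr_eq0.
  apply; rewrite scaler_nat mulr2n (orthonormal_clifford gon (inord j) (inord j)).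
  by rewrite eqxx mulr1.
have GK j (A : 'M[R[i]]_4) : A *m G j *m G j = A by rewrite -mulmxA GG mulmx1.
have Gadj j : map_mx Num.conj (G j)^T = G j.
  by apply/matrixP => i k; rewrite !Gj 2!mxE -herm_mx_adj.
pose W := G 0%N *m G 1%N *m G 2%N *m G 3%N *m G 4%N.
have trW : \tr W = 4 * (\det P)%:C%C.
  rewrite /W !Gj (tr_dirac_mx5 (fun i j => extend (P^~ (inord j)) i)).
  congr (4 * (\det _)%:C%C); apply/matrixP => i j.
  by rewrite mxE extend_ord inord_val.
(* Each [G j] is a Hermitian involution, so the adjoint reverses the product and the ten factors
   cancel from the middle outwards. *)
have Wadj : map_mx Num.conj W^T *m W = 1%:M.
  rewrite /W !trmx_mul !map_mxM !Gadj.
  move: (G 0%N) (G 1%N) (G 2%N) (G 3%N) (G 4%N) (GK 0%N) (GK 1%N) (GK 2%N) (GK 3%N) (GG 4%N).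
  by move=> B0 B1 B2 B3 B4 K0 K1 K2 K3 <-; rewrite !mulmxA K0 K1 K2 K3.
have chiralE : chiral g <-> G 4%N = G 0%N *m G 1%N *m G 2%N *m G 3%N.
  rewrite /chiral /G -!frame_mx_comp; split=> [->//|]; exact: frame_mx_inj.
rewrite chiralE; split=> [G4|P0].
  move: trW; rewrite /W -G4 GG mxtrace1 => /(congr1 (@complex.Re R)) /=.
  by lra.
have detP : \det P = 1 by nra.
suff W1 : W = 1%:M by rewrite -[LHS]mul1mx -W1 GK.
(* The four terms of the expanded trace are [4 - 4 - 4 + 4]. *)
apply/eqP; rewrite -subr_eq0; apply/eqP; apply: trace_adjoint_eq0.
have -> : map_mx Num.conj (W - 1%:M)^T = map_mx Num.conj W^T - 1%:M.
  by rewrite linearB /= map_mxB trmx1 map_mx1.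
rewrite mulmxBl !mulmxBr Wadj mul1mx !mulmx1 !linearB /= mxtrace1 trW detP.
have -> : \tr (map_mx Num.conj W^T) = (\tr W)^*.
  by rewrite /mxtrace rmorph_sum; apply: eq_bigr => i _; rewrite !mxE.
rewrite trW detP rmorphM /= rmorph1 mulr1 conjC_nat; ring.
Qed.

Lemma chiral_herm_basis : chiral (@herm_basis 5).
Proof.
apply/(@chiral_det _ 1%:M); rewrite ?det1//; first exact: orthonormal_herm_basis.
move=> j; rewrite -[LHS]real_comb_delta; congr (real_comb _ _).
by apply/funext => i; rewrite mxE.
Qed.

(** Comparing both frames with the model frame gives [\det Q] and [\det Q * \det P], and chirality
    of [g] makes the former positive. *)
Lemma chiral_change_of_basis (g g' : 'I_5 -> 'End(E)) (P : 'M[R]_5) :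
  orthonormal_basis (theta_invariant h Theta) g -> chiral g ->
  orthonormal_basis (theta_invariant h Theta) g' ->
  (forall j, g' j = real_comb (P^~ j) g) -> (chiral g' <-> 0 < \det P).
Proof.
move=> gon gch g'on g'P.
have [Q gQ] := real_basis_coord real_basis_dirac (fun j => real_basis_mem j gon.1).
have g'QP j : g' j = real_comb ((Q *m P)^~ j) (@herm_basis 5).
  by rewrite g'P (real_comb_mul _ gQ); congr (real_comb _ _); apply/funext => i; rewrite mxE.
have Q0 : 0 < \det Q by apply/(chiral_det gon gQ).
by rewrite (chiral_det g'on g'QP) det_mulmx pmulr_rgt0.
Qed.

End QuaternionicFibre.

(** * Smooth functions *)

Section SmoothFunctions.
Variables (R : realType) (n : nat).
Implicit Types (U : set 'rV[R]_n) (f g : 'rV[R]_n -> R).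

Lemma Ck_on_sub k U U' f : U' `<=` U -> Ck_on k U f -> Ck_on k U' f.
Proof.
move=> U'U; elim: k f => [|k IHk] f /=.
  by move=> fc x; rewrite inE => /U'U Ux; apply: fc; rewrite inE.
move=> [fc fd]; split=> [x|i]; first by rewrite inE => /U'U Ux; apply: fc; rewrite inE.
have [fdi fk] := fd i; split; last exact: IHk.
by move=> x; rewrite inE => /U'U Ux; apply: fdi; rewrite inE.
Qed.

(** On an open set the two functions agree near each point, so their derivatives agree too. *)
Lemma Ck_on_eq k U f g : open U -> (forall x, U x -> f x = g x) -> Ck_on k U f -> Ck_on k U g.
Proof.
move=> Uo; have fg_near u v x : (forall x, U x -> u x = v x) -> U x -> \near x, u x = v x :> R.
  by move=> uv Ux; near=> y; apply: uv; near: y; exact: open_nbhs_nbhs.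
elim: k f g => [|k IHk] f g fg.
  move=> fc x; rewrite inE => Ux; rewrite /continuous_at -(fg _ Ux).
  apply: cvg_trans (fc x (mem_set Ux)).
  exact: (@near_eq_cvg _ _ (nbhs x) _ f g (fg_near f g x fg Ux)).
move=> [fc fd]; split=> [x|i].
  rewrite inE => Ux; rewrite /continuous_at -(fg _ Ux).
  apply: cvg_trans (fc x (mem_set Ux)).
  exact: (@near_eq_cvg _ _ (nbhs x) _ f g (fg_near f g x fg Ux)).
have [fdi fk] := fd i; split=> [x xU|].
  by apply: near_eq_derivable (fdi x xU); apply: fg_near => //; rewrite inE in xU.
by apply: IHk fk => x Ux; apply: near_eq_derive; apply: fg_near.
Unshelve. all: by end_near. Qed.

Lemma Ck_onW k U f : Ck_on k.+1 U f -> Ck_on k U f.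
Proof.
elim: k f => [|k IHk] f; first by case.
by move=> [fc fd]; split=> // i; have [? ?] := fd i; split=> //; apply: IHk.
Qed.

Lemma Ck_on_continuous k U f x : Ck_on k U f -> U x -> {for x, continuous f}.
Proof.
by case: k => [fc|k [fc _]] Ux; apply: fc; rewrite inE.
Qed.

Lemma Ck_on_cst k U a : Ck_on k U (cst a).
Proof.
elim: k a => [|k IHk] a; first by move=> x _; exact: cst_continuous.
split=> [x _|i]; first exact: cst_continuous.
split=> [x _|]; first exact: derivable_cst.
by rewrite (_ : (fun x => _) = cst 0) //; apply/funext => x; rewrite derive_cst.
Qed.

Lemma Ck_on_add k U f g : open U -> Ck_on k U f -> Ck_on k U g -> Ck_on k U (f \+ g).
Proof.
move=> Uo; elim: k f g => [|k IHk] f g.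
  by move=> fc gc x xU; apply: continuousD; [exact: fc|exact: gc].
move=> [fc fd] [gc gd]; split=> [x xU|i].
  by apply: continuousD; [exact: fc|exact: gc].
have [[fdi fk] [gdi gk]] := (fd i, gd i).
split=> [x xU|]; first by apply: derivableD; [exact: fdi|exact: gdi].
apply: Ck_on_eq (IHk _ _ fk gk) => // x /mem_set xU.
by rewrite deriveD//; [exact: fdi|exact: gdi].
Qed.

Lemma Ck_on_mul k U f g : open U -> Ck_on k U f -> Ck_on k U g -> Ck_on k U (f \* g).
Proof.
move=> Uo; elim: k f g => [|k IHk] f g.
  by move=> fc gc x xU; apply: continuousM; [exact: fc|exact: gc].
move=> fk1 gk1; have [[fc fd] [gc gd]] := (fk1, gk1); split=> [x xU|i].
  by apply: continuousM; [exact: fc|exact: gc].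
have [[fdi fk] [gdi gk]] := (fd i, gd i).
split=> [x xU|]; first by apply: derivableM; [exact: fdi|exact: gdi].
have fgk := Ck_on_add Uo (IHk _ _ (Ck_onW fk1) gk) (IHk _ _ (Ck_onW gk1) fk).
apply: Ck_on_eq fgk => // x /mem_set xU.
by rewrite deriveM//; [exact: fdi|exact: gdi].
Qed.

(** The derivative is [- f^-2] times that of [f], so order [k.+1] of the inverse needs only order
    [k] of the inverse itself, which induction supplies. The square root below is treated
    likewise. *)
Lemma Ck_on_inv k U f : open U -> (forall x, U x -> f x != 0) ->
  Ck_on k U f -> Ck_on k U (fun x => (f x)^-1).
Proof.
move=> Uo f0; elim: k => [|k IHk].
  by move=> fc x xU; apply: continuousV; [apply: f0; rewrite inE in xU|exact: fc].
move=> fk1; have [fc fd] := fk1; split=> [x xU|i].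
  by apply: continuousV; [apply: f0; rewrite inE in xU|exact: fc].
have [fdi fk] := fd i; have fVk := IHk (Ck_onW fk1).
split=> [x xU|].
  by apply: derivableV; [apply: f0; rewrite inE in xU|exact: fdi].
have dk := Ck_on_mul Uo (Ck_on_cst k U (-1)) (Ck_on_mul Uo (Ck_on_mul Uo fVk fVk) fk).
apply: Ck_on_eq dk => // x Ux; rewrite deriveV ?f0//; last by apply: fdi; rewrite inE.
by rewrite /= mulN1r scaleNr -expr2 exprVn.
Qed.

(** Restriction to the line through [x] in direction [v] reduces the claim to the one-variable chain
    rule. *)
Lemma is_derive_sqrt_comp f x v : 0 < f x -> derivable f x v ->
  is_derive x v (Num.sqrt \o f) ((2 * Num.sqrt (f x))^-1 * 'D_v f x).
Proof.
move=> fx0 fd.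
pose u (t : R) := f (t *: v + x).
have u0 : u 0 = f x by rewrite /u scale0r add0r.
have ud : derivable u 0 1 := (derivable1P f x v).1 fd.
have lineE g : 'D_v g x = 'D_1 (fun t : R => g (t *: v + x)) 0.
  rewrite /derive; set g1 := fun t => t^-1 *: _; set g2 := fun t => t^-1 *: _.
  suff -> : g1 = g2 by []; apply/funext => t; rewrite /g1 /g2 /=.
  by rewrite addr0 scale0r add0r [_%:A]mulr1.
have sd : is_derive (u 0) 1 Num.sqrt (2 * Num.sqrt (u 0))^-1.
  by apply: is_derive1_sqrt; rewrite u0.
have [sud suE] := is_derive1_comp sd (derivableP ud).
by apply: DeriveDef; [exact: (derivable1P _ _ _).2|rewrite !lineE suE u0].
Qed.

Lemma Ck_on_sqrt k U f : open U -> (forall x, U x -> 0 < f x) ->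
  Ck_on k U f -> Ck_on k U (fun x => Num.sqrt (f x)).
Proof.
move=> Uo f0; elim: k => [|k IHk].
  by move=> fc x xU; apply: continuous_comp; [exact: fc|exact: sqrt_continuous].
move=> fk1; have [fc fd] := fk1; split=> [x xU|i].
  by apply: continuous_comp; [exact: fc|exact: sqrt_continuous].
have [fdi fk] := fd i; have fSk := IHk (Ck_onW fk1).
have sd x : U x -> is_derive x (delta_mx 0 i) (Num.sqrt \o f)
    ((2 * Num.sqrt (f x))^-1 * 'D_(delta_mx 0 i) f x).
  by move=> Ux; apply: is_derive_sqrt_comp; [exact: f0|apply: fdi; rewrite inE].
split=> [x|]; first by rewrite inE => /sd[].
have s0 x : U x -> 2 * Num.sqrt (f x) != 0.
  by move=> /f0 fx0; rewrite mulf_neq0 ?pnatr_eq0// gt_eqF// sqrtr_gt0.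
have dk := Ck_on_mul Uo (Ck_on_inv Uo s0 (Ck_on_mul Uo (Ck_on_cst k U 2) fSk)) fk.
by apply: Ck_on_eq dk => // x /sd[_ /esym].
Qed.

End SmoothFunctions.

(** * Smooth functions on the manifold, read in charts *)

Section ManifoldFunctions.
Variables (R : realType) (T : topologicalType) (n : nat) (A : set (chart R T n)).
Implicit Types (W : set T) (f g : T -> R) (u v : T -> R[i]).

Lemma open_chart_image (c : chart R T n) W : open W -> open (cmap c @` (cdom c `&` W)).
Proof.
move=> Wo; rewrite openE => _ [x [cx Wx] <-]; rewrite /interior /=.
have cimg : (cmap c @` cdom c) (cmap c x) by exists x.
have inv_near : \forall p \near cmap c x, W (cinv c p).
  have := cinv_continuous (mem_set cimg); apply.
  by rewrite cmapK ?inE//; exact: open_nbhs_nbhs.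
have img_near : \forall p \near cmap c x, (cmap c @` cdom c) p.
  by apply: open_nbhs_nbhs; split=> //; exact: cimg_open.
near=> p; have [y cy py] : (cmap c @` cdom c) p by near: p.
exists y => //; split=> //.
have : W (cinv c p) by near: p.
by rewrite -py cmapK// inE.
Unshelve. all: by end_near. Qed.

Lemma smooth_real_sub W W' f : W' `<=` W -> smooth_real A W f -> smooth_real A W' f.
Proof.
move=> W'W fs c Ac k; apply: Ck_on_sub (fs c Ac k).
by move=> _ [x [cx /W'W Wx] <-]; exists x.
Qed.

Lemma smooth_real_eq W f g : open W -> (forall x, W x -> f x = g x) ->
  smooth_real A W f -> smooth_real A W g.
Proof.
move=> Wo fg fs c Ac k; apply: Ck_on_eq (fs c Ac k); first exact: open_chart_image.
by move=> _ [x [cx Wx] <-] /=; rewrite cmapK ?inE// fg.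
Qed.

Lemma smooth_real_cst W a : smooth_real A W (cst a).
Proof. by move=> c _ k; exact: Ck_on_cst. Qed.

Lemma smooth_realD W f g : open W -> smooth_real A W f -> smooth_real A W g ->
  smooth_real A W (fun x => f x + g x).
Proof.
by move=> Wo fs gs c Ac k; exact: (Ck_on_add (open_chart_image Wo) (fs c Ac k) (gs c Ac k)).
Qed.

Lemma smooth_realM W f g : open W -> smooth_real A W f -> smooth_real A W g ->
  smooth_real A W (fun x => f x * g x).
Proof.
by move=> Wo fs gs c Ac k; exact: (Ck_on_mul (open_chart_image Wo) (fs c Ac k) (gs c Ac k)).
Qed.

Lemma smooth_realN W f : open W -> smooth_real A W f -> smooth_real A W (fun x => - f x).
Proof.
move=> Wo fs; apply: smooth_real_eq (smooth_realM Wo (smooth_real_cst W (-1)) fs) => //.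
by move=> x _; rewrite /= mulN1r.
Qed.

Lemma smooth_real_rsqrt W f : open W -> (forall x, W x -> 0 < f x) ->
  smooth_real A W f -> smooth_real A W (fun x => (Num.sqrt (f x))^-1).
Proof.
move=> Wo f0 fs c Ac k; have Uo := open_chart_image Wo.
have fc0 p : (cmap c @` (cdom c `&` W)) p -> 0 < f (cinv c p).
  by move=> [x [cx Wx] <-]; rewrite cmapK ?inE// f0.
have s0 p : (cmap c @` (cdom c `&` W)) p -> Num.sqrt (f (cinv c p)) != 0.
  by move=> /fc0 fp0; rewrite gt_eqF// sqrtr_gt0.
exact: (Ck_on_inv (Uo c) s0 (Ck_on_sqrt (Uo c) fc0 (fs c Ac k))).
Qed.

(** Smoothness is known only in charts, so continuity at a point is recovered by composing
    [f \o cinv c] with [cmap c] for a chart around it. *)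
Lemma open_nonzero W f : (forall x, exists2 c, A c & cdom c x) -> open W ->
  smooth_real A W f -> open (W `&` [set x | f x != 0]).
Proof.
move=> Acov Wo fs; rewrite openE => x [Wx fx0]; rewrite /interior /=.
have [c Ac cx] := Acov x.
have imgx : (cmap c @` (cdom c `&` W)) (cmap c x) by exists x.
have fcont := Ck_on_continuous (fs c Ac 0%N) imgx.
have near_p : \forall p \near cmap c x, f (cinv c p) != 0.
  apply: (fcont [set r | r != 0]); apply: open_nbhs_nbhs; split; first exact: open_neq.
  by rewrite /= cmapK ?inE.
have near_x : \forall y \near x, f (cinv c (cmap c y)) != 0.
  by have cc := cmap_continuous (mem_set cx); exact: (cc [set p | f (cinv c p) != 0] near_p).
have near_c : \forall y \near x, cdom c y.
  by apply: open_nbhs_nbhs; split=> //; exact: cdom_open.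
have near_W : \forall y \near x, W y by exact: open_nbhs_nbhs.
near=> y; split; first by near: y.
have cy : cdom c y by near: y.
by rewrite /= -{1}[y](cmapK (mem_set cy)); near: y.
Unshelve. all: by end_near. Qed.

Lemma smooth_complex_sub W W' u : W' `<=` W -> smooth_complex A W u -> smooth_complex A W' u.
Proof. by move=> W'W [ru iu]; split; apply: smooth_real_sub W'W _. Qed.

Lemma smooth_complex_eq W u v : open W -> (forall x, W x -> u x = v x) ->
  smooth_complex A W u -> smooth_complex A W v.
Proof.
by move=> Wo uv [ru iu]; split; [apply: smooth_real_eq ru|apply: smooth_real_eq iu] => // x Wx;
  rewrite uv.
Qed.

Lemma smooth_complex_cst W a : smooth_complex A W (cst a).
Proof. by split; exact: smooth_real_cst. Qed.

Lemma smooth_complexD W u v : open W -> smooth_complex A W u -> smooth_complex A W v ->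
  smooth_complex A W (fun x => u x + v x).
Proof.
move=> Wo [ru iu] [rv iv]; split.
  by apply: smooth_real_eq (smooth_realD Wo ru rv) => // x _; case: (u x) (v x) => ? ? [].
by apply: smooth_real_eq (smooth_realD Wo iu iv) => // x _; case: (u x) (v x) => ? ? [].
Qed.

Lemma smooth_complexM W u v : open W -> smooth_complex A W u -> smooth_complex A W v ->
  smooth_complex A W (fun x => u x * v x).
Proof.
move=> Wo [ru iu] [rv iv]; split.
  have := smooth_realD Wo (smooth_realM Wo ru rv) (smooth_realN Wo (smooth_realM Wo iu iv)).
  by apply: smooth_real_eq => // x _; case: (u x) (v x) => ? ? [].
have := smooth_realD Wo (smooth_realM Wo ru iv) (smooth_realM Wo iu rv).
by apply: smooth_real_eq => // x _; case: (u x) (v x) => ? ? [].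
Qed.

Lemma smooth_complex_conj W u : open W -> smooth_complex A W u ->
  smooth_complex A W (fun x => (u x)^*).
Proof.
move=> Wo [ru iu]; split.
  by apply: smooth_real_eq ru => // x _; case: (u x).
by apply: smooth_real_eq (smooth_realN Wo iu) => // x _; case: (u x).
Qed.

Lemma smooth_complex_real W f : smooth_real A W f -> smooth_complex A W (fun x => (f x)%:C%C).
Proof. by split=> //; exact: smooth_real_cst. Qed.

Lemma smooth_complex_sum W (I : Type) (r : seq I) (u : I -> T -> R[i]) : open W ->
  (forall k, smooth_complex A W (u k)) ->
  smooth_complex A W (fun x => \sum_(k <- r) u k x).
Proof.
move=> Wo us; elim: r => [|k r IHr].
  by apply: smooth_complex_eq (smooth_complex_cst W 0) => // x _; rewrite big_nil.
apply: smooth_complex_eq (smooth_complexD Wo (us k) IHr) => // x _.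
by rewrite big_cons.
Qed.

End ManifoldFunctions.

(** * Smooth quaternionic frames *)

Section OrthonormalFamilies.
Variables (R : realType) (E : vectType R[i]) (h : E -> E -> R[i]) (Theta : E -> E).
Hypotheses (hh : fibre_metric h) (h_pos : forall u, u != 0 -> 0 < h u u).
Hypotheses (Th : antilinear Theta) (ThK : forall u, Theta (Theta u) = - u)
  (Th_unitary : forall u v, h (Theta u) (Theta v) = (h u v)^*).

Lemma metricZl (a : R[i]) u v : h (a *: u) v = a^* * h u v.
Proof. by rewrite hh.2 metricZ// rmorphM /= -hh.2. Qed.

Lemma metric_self_real u : h u u = (complex.Re (h u u))%:C%C.
Proof.
have := hh.2 u u; case: (h u u) => a b [] bN.
by congr Complex; lra.
Qed.

Lemma metric_self_gt0 u : u != 0 -> 0 < complex.Re (h u u).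
Proof. by move=> /h_pos; rewrite metric_self_real ltcR. Qed.

Lemma metric_normalize u (r := ((Num.sqrt (complex.Re (h u u)))^-1)%:C%C) :
  u != 0 -> h (r *: u) (r *: u) = 1.
Proof.
move=> /metric_self_gt0 hu0; rewrite metricZl metricZ// metric_self_real /r.
rewrite conjE conjc_real -!rmorphM /=; congr (_%:C%C); rewrite mulrA -invfM -expr2 sqr_sqrtr ?ltW//.
by rewrite mulVf// gt_eqF.
Qed.

Lemma metric_Theta_orth u : h u (Theta u) = 0.
Proof.
have := Th_unitary u (Theta u); rewrite ThK -scaleN1r metricZ// [h (Theta u) u]hh.2.
by case: (h u (Theta u)) => a b [] ? ?; congr Complex; lra.
Qed.

Lemma orthonormal_expand n (e : 'I_n -> E) : \dim {:E} = n ->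
  (forall i j, h (e i) (e j) = (i == j)%:R) -> forall u, u = \sum_i h (e i) u *: e i.
Proof.
move=> dimE on u; pose X := [tuple e i | i < n].
have dot (c : 'I_n -> R[i]) i : h (e i) (\sum_j c j *: e j) = c i.
  rewrite metric_sum// (bigD1 i)//= on eqxx mulr1 big1 ?addr0// => j /negPf ji.
  by rewrite on eq_sym ji mulr0.
have XE (c : 'I_n -> R[i]) : \sum_(i < n) c i *: X`_i = \sum_i c i *: e i.
  by apply: eq_bigr => i _; rewrite -tnth_nth tnth_mktuple.
have Xfree : free X.
  by apply/freeP => c; rewrite XE => c0 i; rewrite -(dot c i) c0 metric0.
have Xbasis : basis_of {:E} X by rewrite basisEfree Xfree subvf size_tuple dimE /=.
rewrite {1}(coord_basis Xbasis (memvf u)) XE; apply: eq_bigr => i _; congr (_ *: _).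
by rewrite {2}(coord_basis Xbasis (memvf u)) XE dot.
Qed.

(** Conjugate symmetry, antiunitarity and [Theta^2 = -1] derive all sixteen scalar products from the
    four that are assumed; orthonormality in dimension 4 then gives the expansion. *)
Lemma quaternionic_frame_pair u w : \dim {:E} = 4 ->
  h u u = 1 -> h w w = 1 -> h u w = 0 -> h (Theta u) w = 0 ->
  quaternionic_frame h Theta (fun i : 'I_4 => nth 0 [:: u; Theta u; w; Theta w] i).
Proof.
move=> dimE uu ww uw Tuw.
have wu : h w u = 0 by rewrite hh.2 uw conjC0.
have wTu : h w (Theta u) = 0 by rewrite hh.2 Tuw conjC0.
have TuTw : h (Theta u) (Theta w) = 0 by rewrite Th_unitary uw conjC0.
have TwTu : h (Theta w) (Theta u) = 0 by rewrite Th_unitary wu conjC0.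
have uTw : h u (Theta w) = 0.
  apply: (can_inj conjCK); rewrite -Th_unitary ThK -scaleN1r metricZ// Tuw mulr0.
  by rewrite conjC0.
have Twu : h (Theta w) u = 0 by rewrite hh.2 uTw conjC0.
have TuTu : h (Theta u) (Theta u) = 1 by rewrite Th_unitary uu conjC1.
have TwTw : h (Theta w) (Theta w) = 1 by rewrite Th_unitary ww conjC1.
have uTu := metric_Theta_orth u; have wTw := metric_Theta_orth w.
have Tuu : h (Theta u) u = 0 by rewrite hh.2 uTu conjC0.
have Tww : h (Theta w) w = 0 by rewrite hh.2 wTw conjC0.
have on (i j : 'I_4) : h (nth 0 [:: u; Theta u; w; Theta w] i)
    (nth 0 [:: u; Theta u; w; Theta w] j) = (i == j)%:R.
  by case: i => [[|[|[|[|i]]]] hi] //=; case: j => [[|[|[|[|j]]]] hj].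
split=> // [|i j]; first exact: orthonormal_expand.
have hN v v' : h v (- v') = - h v v' by rewrite -scaleN1r metricZ// mulN1r.
rewrite mxE.
by case: i => [[|[|[|[|i]]]] hi] //=; case: j => [[|[|[|[|j]]]] hj] //=;
  rewrite ?ThK ?hN
    ?(uu, ww, uw, Tuw, wu, wTu, TuTw, TwTu, uTw, Twu, TuTu, TwTw, uTu, wTw, Tuu, Tww) ?oppr0.
Qed.

(** For a unit vector [u], this is the Gram-Schmidt remainder of [v] modulo the quaternionic line of
    [u]. *)
Definition orthogonal_part u v := v - h u v *: u - h (Theta u) v *: Theta u.

Lemma orthogonal_part_orth u v : h u u = 1 ->
  h u (orthogonal_part u v) = 0 /\ h (Theta u) (orthogonal_part u v) = 0.
Proof.
move=> uu; have hB w v1 v2 : h w (v1 - v2) = h w v1 - h w v2.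
  by rewrite metricD// -scaleN1r metricZ// mulN1r.
rewrite /orthogonal_part !hB !metricZ// uu metric_Theta_orth [h (Theta u) u]hh.2 metric_Theta_orth.
by rewrite Th_unitary uu conjC0 conjC1 !mulr0 !mulr1 subrr !subr0 subrr.
Qed.

(** Otherwise [u] and [Theta u] would span the whole space. *)
Lemma orthogonal_part_neq0 u : (2 < \dim {:E})%N -> exists v, orthogonal_part u v != 0.
Proof.
move=> dimE; apply: contrapT => /forallNP noall; move: dimE; apply/negP; rewrite -leqNgt.
apply: leq_trans (dim_span [:: u; Theta u]); apply: dimvS; apply/subvP => v _.
have := noall v; move/negP; rewrite negbK /orthogonal_part -addrA -opprD subr_eq0 => /eqP ->.
by rewrite rpredD// rpredZ// memv_span// !inE eqxx ?orbT.
Qed.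

End OrthonormalFamilies.

(** * Smooth sections and their coordinates in trivializations *)

Section SmoothSections.
Variables (R : realType) (T : topologicalType) (n r : nat) (A : set (chart R T n)).
Variables (S : T -> vectType R[i]) (V : set (trivialization S r)).
Implicit Types (t : trivialization S r) (W : set T) (s : forall x, S x).

Definition smooth_coords t W s : Prop :=
  forall i, smooth_complex A W (fun x => tmap t x (s x) i 0).

Lemma trivializationK t x : tdom t x -> cancel (tmap t x) (tmap t x)^-1%VF.
Proof.
by move=> tx; apply: lker0_lfunK; apply/lker0P; exact: bij_inj (tmap_bij tx).
Qed.

Lemma trivializationVK t x : tdom t x -> cancel (tmap t x)^-1%VF (tmap t x).
Proof.
move=> tx v; have [f _ fK] := tmap_bij tx.
by rewrite -[v]fK trivializationK.
Qed.

Lemma trivialization_dim t x : tdom t x -> \dim {:S x} = r.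
Proof.
move=> tx; have ker0 : (fullv :&: lker (tmap t x))%VS = 0%VS.
  by apply/eqP; rewrite capfv; apply/lker0P; exact: bij_inj (tmap_bij tx).
rewrite -(limg_dim_eq ker0).
have -> : limg (tmap t x) = fullv.
  apply/eqP; rewrite eqEsubv subvf /=; apply/subvP => v _.
  by rewrite -(trivializationVK tx v) memv_img ?memvf.
by rewrite dimvf /dim /= muln1.
Qed.

Definition triv_basis t (j : 'I_r) x : S x := (tmap t x)^-1%VF (delta_mx j 0).

Lemma triv_expand t x (u : S x) : tdom t x ->
  u = \sum_j tmap t x u j 0 *: triv_basis t j x.
Proof.
move=> tx; rewrite -{1}[u](trivializationK tx).
have {1}-> : tmap t x u = \sum_j tmap t x u j 0 *: delta_mx j 0.
  rewrite {1}[tmap t x u]matrix_sum_delta; apply: eq_bigr => j _.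
  by rewrite big_ord1.
by rewrite linear_sum; apply: eq_bigr => j _; exact: linearZ.
Qed.

Lemma smooth_coords_cst t W v : W `<=` tdom t -> open W ->
  smooth_coords t W (fun x => (tmap t x)^-1%VF v).
Proof.
move=> Wt Wo i; apply: smooth_complex_eq (smooth_complex_cst A W (v i 0)) => // x /Wt tx.
by rewrite trivializationVK.
Qed.

Lemma smooth_coordsD t W s s' : open W -> smooth_coords t W s -> smooth_coords t W s' ->
  smooth_coords t W (fun x => s x + s' x).
Proof.
move=> Wo ss ss' i; apply: smooth_complex_eq (smooth_complexD Wo (ss i) (ss' i)) => // x _.
by rewrite linearD mxE.
Qed.

Lemma smooth_coordsZ t W f s : open W -> smooth_complex A W f -> smooth_coords t W s ->
  smooth_coords t W (fun x => f x *: s x).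
Proof.
move=> Wo fs ss i; apply: smooth_complex_eq (smooth_complexM Wo fs (ss i)) => // x _.
by rewrite linearZ mxE.
Qed.

Hypothesis hV : vector_bundle A V.

(** Frames are built in one trivialization, while smoothness of a bundle map is tested in all of
    them. The new coordinates are the old ones times transition functions of basis vectors. *)
Lemma smooth_coords_change t t' W s : V t -> V t' -> open W -> W `<=` tdom t ->
  smooth_coords t W s -> smooth_coords t' (W `&` tdom t') s.
Proof.
move=> Vt Vt' Wo Wt ss i; have Wo' : open (W `&` tdom t') by apply: openI => //; exact: tdom_open.
have sub : W `&` tdom t' `<=` tdom t `&` tdom t' by move=> x [/Wt].
apply: smooth_complex_eq (smooth_complex_sum (index_enum 'I_r) Wo' (fun j => smooth_complexM Wo'
  (smooth_complex_sub (@subIsetl _ W (tdom t')) (ss j))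
  (smooth_complex_sub sub (hV.2 t t' Vt Vt' (delta_mx j 0) i)))) => // x [/Wt tx _].
rewrite {2}(triv_expand (s x) tx) linear_sum summxE; apply: eq_bigr => j _.
by rewrite linearZ mxE.
Qed.

Variable h : forall x, S x -> S x -> R[i].
Hypothesis hh : hermitian_metric A V h.

Lemma bundle_fibre_metric x : fibre_metric (@h x).
Proof. by have [lin cnj _ _] := hh; split=> *; [exact: lin|exact: cnj]. Qed.

(** The metric is assumed smooth on vectors of constant coordinates; sesquilinear expansion in the
    trivialization basis extends this to all smooth sections. *)
Lemma smooth_metric t W s s' : V t -> open W -> W `<=` tdom t ->
  smooth_coords t W s -> smooth_coords t W s' ->
  smooth_complex A W (fun x => h (s x) (s' x)).
Proof.
move=> Vt Wo Wt ss ss'; have [_ _ _ hs] := hh.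
apply: smooth_complex_eq (smooth_complex_sum (index_enum 'I_r) Wo (fun j =>
  smooth_complex_sum (index_enum 'I_r) Wo (fun k => smooth_complexM Wo
    (smooth_complexM Wo (smooth_complex_conj Wo (ss j)) (ss' k))
    (smooth_complex_sub Wt (hs t Vt (delta_mx j 0) (delta_mx k 0)))))) => // x /Wt tx.
have hx := bundle_fibre_metric x.
rewrite {2}(triv_expand (s x) tx) {2}(triv_expand (s' x) tx) (metric_sum hx) exchange_big.
apply: eq_bigr => k _; rewrite /= [h (\sum_j _) _]hx.2 (metric_sum hx) rmorph_sum mulr_sumr.
apply: eq_bigr => j _ /=; rewrite rmorphM /= -hx.2.
by rewrite mulrCA !mulrA.
Qed.

Variable Theta : forall x, S x -> S x.
Hypothesis hTheta : quaternionic_structure A V h Theta.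

Lemma bundle_antilinear x : antilinear (@Theta x).
Proof. by have [_ lin _ _] := hTheta => *; exact: lin. Qed.

Lemma smooth_coords_Theta t W s : V t -> open W -> W `<=` tdom t ->
  smooth_coords t W s -> smooth_coords t W (fun x => Theta (s x)).
Proof.
move=> Vt Wo Wt ss i; have [Ts _ _ _] := hTheta.
have sub : W `<=` setT `&` tdom t by move=> x /Wt.
apply: smooth_complex_eq (smooth_complex_sum (index_enum 'I_r) Wo (fun j => smooth_complexM Wo
  (smooth_complex_conj Wo (ss j))
  (smooth_complex_sub sub (Ts t Vt (delta_mx j 0) i)))) => // x /Wt tx.
rewrite {2}(triv_expand (s x) tx) (antilinear_sum (@bundle_antilinear x)) linear_sum summxE.
by apply: eq_bigr => j _; rewrite linearZ mxE.
Qed.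

End SmoothSections.

(** * Adapted frames and the chiral orientation of the bundle *)

Section QuaternionicBundle.
Variables (R : realType) (T : topologicalType) (n : nat) (A : set (chart R T n)).
Variables (S : T -> vectType R[i]) (V : set (trivialization S 4)).
Variables (h : forall x, S x -> S x -> R[i]) (Theta : forall x, S x -> S x).
Hypotheses (A_cover : forall x, exists2 c, A c & cdom c x) (hV : vector_bundle A V).
Hypotheses (hh : hermitian_metric A V h) (hTheta : quaternionic_structure A V h Theta).

Let hx x := bundle_fibre_metric hh x.
Let Thx x : antilinear (@Theta x) := @bundle_antilinear _ _ _ _ _ _ _ _ _ hTheta x.

Lemma bundle_metric_pos x (u : S x) : u != 0 -> 0 < h u u.
Proof. by have [_ _ pos _] := hh; exact: pos. Qed.

Lemma bundle_ThetaK x (u : S x) : Theta (Theta u) = - u.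
Proof. by have [_ _ _ ThK] := hTheta; exact: ThK. Qed.

Lemma bundle_Theta_unitary x (u v : S x) : h (Theta u) (Theta v) = (h u v)^*.
Proof. by have [_ _ ThU _] := hTheta; exact: ThU. Qed.

Lemma smooth_coords_normalize t W (s : forall x, S x) : V t -> open W -> W `<=` tdom t ->
  (forall x, W x -> s x != 0) -> smooth_coords A t W s ->
  smooth_coords A t W (fun x => ((Num.sqrt (complex.Re (h (s x) (s x))))^-1)%:C%C *: s x).
Proof.
move=> Vt Wo Wt s0 ss; apply: smooth_coordsZ => //; apply: smooth_complex_real.
apply: smooth_real_rsqrt => // [x /s0|]; last by have [] := smooth_metric hh Vt Wo Wt ss ss.
exact: (metric_self_gt0 (hx x) (@bundle_metric_pos x)).
Qed.

Definition adapted_frame t W (e : 'I_4 -> forall x, S x) : Prop :=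
  [/\ V t, open W, W `<=` tdom t, forall i, smooth_coords A t W (e i) &
      forall x, W x -> quaternionic_frame (@h x) (@Theta x) (fun i => e i x)].

Lemma adapted_frame_exists x0 : exists t W e, adapted_frame t W e /\ W x0.
Proof.
have [t Vt tx0] := hV.1 x0; have to := @tdom_open _ _ _ _ t.
have tt : tdom t `<=` tdom t by [].
pose normalize (s : forall x, S x) x :=
  ((Num.sqrt (complex.Re (h (s x) (s x))))^-1)%:C%C *: s x.
pose b x : S x := (tmap t x)^-1%VF (delta_mx ord0 0).
have b0 x : tdom t x -> b x != 0.
  move=> tx; apply/eqP => /(congr1 (tmap t x)); rewrite trivializationVK// linear0.
  by move/matrixP/(_ ord0 0); rewrite !mxE !eqxx /=; apply/eqP; rewrite oner_eq0.
have bs : smooth_coords A t (tdom t) b by apply: smooth_coords_cst.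
pose u := normalize b.
have us : smooth_coords A t (tdom t) u by apply: smooth_coords_normalize.
have uu x : tdom t x -> h (u x) (u x) = 1.
  by move=> /b0; exact: (metric_normalize (hx x) (@bundle_metric_pos x)).
have dim4 x : tdom t x -> \dim {:S x} = 4 by exact: trivialization_dim.
(* The second vector is chosen at [x0] alone and then extended with constant coordinates, which
   keeps it smooth. *)
have [v0 v0_neq] : exists v, orthogonal_part (@h x0) (@Theta x0) (u x0) v != 0.
  by apply: orthogonal_part_neq0; rewrite dim4.
pose v x : S x := (tmap t x)^-1%VF (tmap t x0 v0).
have vx0 : v x0 = v0 by rewrite /v trivializationK.
pose p x := orthogonal_part (@h x) (@Theta x) (u x) (v x).
have vs : smooth_coords A t (tdom t) v by apply: smooth_coords_cst.
have Tus : smooth_coords A t (tdom t) (fun x => Theta (u x)) :=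
  smooth_coords_Theta hTheta Vt to tt us.
have ps : smooth_coords A t (tdom t) p.
  have sN s : smooth_coords A t (tdom t) s -> smooth_coords A t (tdom t) (fun x => - s x).
    move=> /(smooth_coordsZ to (smooth_complex_cst A (tdom t) (-1))).
    by move=> sNs i; apply: smooth_complex_eq (sNs i) => // x _; rewrite /= scaleN1r.
  by do 2 (apply: smooth_coordsD => //; last by apply: sN; apply: smooth_coordsZ => //;
    apply: (smooth_metric hh Vt)).
have [pp_smooth _] := smooth_metric hh Vt to tt ps ps.
(* Away from [x0] the remainder may vanish, so the domain shrinks to the points where its squared
   norm is nonzero. *)
have Wo := open_nonzero A_cover to pp_smooth; set W := _ `&` _ in Wo.
have Wt : W `<=` tdom t by move=> x [].
have p0 x : W x -> p x != 0.
  by move=> [_ /=]; apply: contra_neq => ->; rewrite (metric0 (hx x)).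
pose w := normalize p.
have ws : smooth_coords A t W w.
  apply: smooth_coords_normalize => // i; exact: smooth_complex_sub (ps i).
exists t, W, (fun i x => nth 0 [:: u x; Theta (u x); w x; Theta (w x)] i).
split; last first.
  split=> //=; rewrite gt_eqF// (metric_self_gt0 (hx x0) (@bundle_metric_pos x0))//.
  by rewrite /p vx0.
split=> //.
  have usW : smooth_coords A t W u by move=> i; exact: smooth_complex_sub (us i).
  case=> [[|[|[|[|i]]]] hi] //=.
    exact: (smooth_coords_Theta hTheta Vt Wo Wt usW).
  exact: (smooth_coords_Theta hTheta Vt Wo Wt ws).
move=> x Wx; have tx := Wt _ Wx.
have [up Tup] := orthogonal_part_orth (hx x) (@bundle_ThetaK x) (@bundle_Theta_unitary x)
  (v x) (uu x tx).
apply: quaternionic_frame_pair => //.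
- exact: bundle_ThetaK.
- exact: bundle_Theta_unitary.
- exact: dim4.
- exact: uu.
- exact: (metric_normalize (hx x) (@bundle_metric_pos x) (p0 x Wx)).
- by rewrite (metricZ (hx x)) up mulr0.
- by rewrite (metricZ (hx x)) Tup mulr0.
Qed.

Section AdaptedFrame.
Variables (t : trivialization S 4) (W : set T) (e : 'I_4 -> forall x, S x).
Hypothesis eW : adapted_frame t W e.

(** With [M] constant, the image of a vector is a combination of the smooth [e k] whose coefficients
    are smooth because the metric is. *)
Lemma smooth_frame_lfun M :
  smooth_bundle_map A V W (fun x => frame_lfun (@h x) (fun i => e i x) M).
Proof.
move=> t' Vt' v i; have [Vt Wo Wt es _] := eW.
have W'o : open (W `&` tdom t') by apply: openI => //; exact: tdom_open.
have W't' : W `&` tdom t' `<=` tdom t' by move=> x [].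
have es' k := smooth_coords_change hV Vt Vt' Wo Wt (es k).
apply: smooth_complex_eq (smooth_complex_sum (index_enum 'I_4) W'o (fun k =>
  smooth_complexM W'o (smooth_complex_sum (index_enum 'I_4) W'o (fun j =>
    smooth_complexM W'o (smooth_complex_cst A _ (M k j))
      (smooth_metric hh Vt' W'o W't' (es' j) (smooth_coords_cst A v W't' W'o))))
    (es' k i))) => // x _.
rewrite (frame_lfunE _ (hx x)) linear_sum summxE; apply: eq_bigr => k _.
by rewrite linearZ mxE.
Qed.

Lemma smooth_frame_hermitian : smooth_frame A V (fun x => traceless_hermitian (@h x)) W
  (fun (k : 'I_15) x => herm_basis (@h x) (fun i => e i x) k).
Proof.
have [_ _ _ _ qe] := eW.
by split=> [k|x /qe]; [exact: smooth_frame_lfun|exact: real_basis_hermitian].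
Qed.

Lemma smooth_frame_dirac : smooth_frame A V (fun x => theta_invariant (@h x) (@Theta x)) W
  (fun (k : 'I_5) x => herm_basis (@h x) (fun i => e i x) k).
Proof.
have [_ _ _ _ qe] := eW.
by split=> [k|x /qe]; [exact: smooth_frame_lfun|exact: real_basis_dirac].
Qed.

End AdaptedFrame.

(** An orientation consists of arbitrary bases, so the chiral orthonormal frames are saturated under
    positive determinant. No adapted frame enters, hence nothing has to be glued. *)
Definition dirac_orientation x : set ('I_5 -> 'End(S x)) :=
  [set b | exists g (P : 'M[R]_5),
    [/\ orthonormal_basis (theta_invariant (@h x) (@Theta x)) g, chiral g, 0 < \det P &
        forall j, b j = real_comb (P^~ j) g]].

Lemma real_comb_1 x (g : 'I_5 -> 'End(S x)) j : g j = real_comb ((1%:M : 'M[R]_5)^~ j) g.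
Proof.
by rewrite -[LHS](real_comb_delta g); congr real_comb; apply/funext => i; rewrite mxE.
Qed.

Lemma dirac_orientation_chiral x (g : 'I_5 -> 'End(S x)) :
  orthonormal_basis (theta_invariant (@h x) (@Theta x)) g ->
  (dirac_orientation g <-> chiral g).
Proof.
move=> gon; split=> [[g' [P [g'on g'ch P0 gP]]]|gch]; last first.
  by exists g, 1%:M; split=> //; [rewrite det1|exact: real_comb_1].
have [t [W [e [[_ _ _ _ qe] /qe qx]]]] := adapted_frame_exists x.
by rewrite (chiral_change_of_basis (hx x) (@Thx x) qx g'on g'ch gon gP).
Qed.

Lemma dirac_space_orientation x :
  space_orientation (theta_invariant (@h x) (@Theta x)) (@dirac_orientation x).
Proof.
have [t [W [e [[_ _ _ _ qe] /qe qx]]]] := adapted_frame_exists x.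
have gon := orthonormal_herm_basis (hx x) (@Thx x) qx.
have gch := chiral_herm_basis (hx x) (@Thx x) qx.
split; first by exists (@herm_basis _ _ (@h x) (fun i => e i x) 5); apply/dirac_orientation_chiral.
move=> b [g [P [gon' gch' P0 bP]]].
have Pu : P \in unitmx by rewrite unitmxE unitfE gt_eqF.
split=> [|Q b' b'F b'Q]; first exact: real_basis_unit gon'.1 bP Pu.
have b'PQ j : b' j = real_comb ((P *m Q)^~ j) g.
  by rewrite b'Q (real_comb_mul _ bP); congr real_comb; apply/funext => i; rewrite mxE.
split=> [[g2 [P2 [g2on g2ch P20 b'P2]]]|Q0].
  have [D g2D] := real_basis_coord gon'.1 (fun j => real_basis_mem j g2on.1).
  have D0 : 0 < \det D.
    by apply/(chiral_change_of_basis (hx x) (@Thx x) qx gon' gch' g2on g2D).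
  (* Both [D *m P2] and [P *m Q] express [b'] in [g], so [\det P * \det Q = \det D * \det P2], a
     product of positive numbers. *)
  have := real_basis_mulmx gon'.1 g2D b'P2 b'PQ => /(congr1 determinant).
  rewrite !det_mulmx => PQE.
  by rewrite -(pmulr_rgt0 _ P0) PQE mulr_gt0.
by exists g, (P *m Q); split=> //; rewrite det_mulmx mulr_gt0.
Qed.

Lemma dirac_bundle_orientation :
  bundle_orientation A V (fun x => theta_invariant (@h x) (@Theta x)) dirac_orientation.
Proof.
split=> [x|x]; first exact: dirac_space_orientation.
have [t [W [e [eW Wx]]]] := adapted_frame_exists x.
have [_ Wo _ _ qe] := eW.
exists W, (fun k y => herm_basis (@h y) (fun i => e i y) k).
split=> // [|y /qe qy]; first exact: smooth_frame_dirac eW.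
apply/dirac_orientation_chiral; first exact: orthonormal_herm_basis.
exact: (chiral_herm_basis (hx y) (@Thx y)).
Qed.

End QuaternionicBundle.

Theorem proposition4p3 (R : realType) (T : topologicalType)
    (A OT : set (chart R T 5))
    (hT : smooth_manifold A) (hOT : manifold_orientation A OT)
    (T_compact : compact [set: T]) (T_connected : connected [set: T])
    (S : T -> vectType R[i]) (V : set (trivialization S 4))
    (hS : vector_bundle A V)
    (h : forall x, S x -> S x -> R[i]) (hh : hermitian_metric A V h)
    (Theta : forall x, S x -> S x) (hTheta : quaternionic_structure A V h Theta) :
  let H0 := fun x => traceless_hermitian (h x) in
  let H0l := fun x => theta_invariant (h x) (Theta x) in
  [/\ real_subbundle A V 5 H0l H0,
      bundle_orientable A V 5 H0l,
      forall x, exists W (gamma : 'I_5 -> forall x, 'End(S x)),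
        [/\ open W, W x, smooth_frame A V H0l W gamma &
            forall y, W y ->
              orthonormal_basis (H0l y) (fun i => gamma i y) /\
              clifford (fun i => gamma i y)] &
      exists O : forall x, set ('I_5 -> 'End(S x)),
        bundle_orientation A V H0l O /\
        forall x (gamma : 'I_5 -> 'End(S x)),
          orthonormal_basis (H0l x) gamma -> (O x gamma <-> chiral gamma)].
Proof.
move=> H0 H0l; have [_ _ [A_cover _ _]] := hT.
have adapted x := adapted_frame_exists A_cover hS hh hTheta x.
split.
(* The complement has rank [10 = 15 - 5]; the first five sections of the Hermitian frame form the
   Dirac frame. *)
- exists 10%N => x; have [t [W [e [eW Wx]]]] := adapted x; have [_ Wo _ _ _] := eW.
  exists W, (fun k y => herm_basis (h y) (fun i => e i y) k); split=> //.
    exact: smooth_frame_hermitian eW.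
  exact: smooth_frame_dirac eW.
- exists (@dirac_orientation _ _ _ h Theta).
  exact: (dirac_bundle_orientation A_cover hS hh hTheta).
- move=> x; have [t [W [e [eW Wx]]]] := adapted x; have [_ Wo _ _ qe] := eW.
  exists W, (fun k y => herm_basis (h y) (fun i => e i y) k); split=> //.
    exact: smooth_frame_dirac eW.
  move=> y /qe qy; have hy := bundle_fibre_metric hh y.
  have Ty := @bundle_antilinear _ _ _ _ _ _ _ _ _ hTheta y.
  have on := orthonormal_herm_basis hy Ty qy.
  by split=> //; exact: (orthonormal_clifford hy Ty qy on).
exists (@dirac_orientation _ _ _ h Theta); split=> [|x gamma gon].
  exact: (dirac_bundle_orientation A_cover hS hh hTheta).
exact: (dirac_orientation_chiral A_cover hS hh hTheta gon).
Qed.
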